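(* Let $R$ be a commutative noetherian ring and $C$ a semidualizing $R$-module. Assume that $x,y\in R$ form a pair of exact zero-divisors on both $R$ and $C$. Let $M$ be an $R$-module such that $xM\neq0$ and $xM\neq M$. If $\mathcal P_C\text{-}\operatorname{pd}(M)$, $\mathcal F_C\text{-}\operatorname{pd}(M)$, or $\mathcal I_C\text{-}\operatorname{id}(M)$ is finite, then $x,y$ form a pair of exact zero-divisors on $M$.
   Context: Rings are commutative noetherian with identity; ''finite'' module means finitely generated module. A finite $R$-module $C$ is semidualizing if the natural homothety map $R\to\operatorname{Hom}_R(C,C)$ is an isomorphism and $\operatorname{Ext}^i_R(C,C)=0$ for all $i>0$. For an $R$-module $M$ and $x,y\in R$, one says that $x,y$ form a pair of exact zero-divisors on $M$ if $xM\neq 0$, $xM\neq M$ and the sequence of multiplication maps $M\xrightarrow{x}M\xrightarrow{y}M\xrightarrow{x}M$ is exact. Classes of $C$-projective, $C$-flat and $C$-injective $R$-modules: $\mathcal P_C=\{C\otimes_RP\mid P \text{ projective}\}$, $\mathcal F_C=\{C\otimes_RF\mid F\text{ flat}\}$, $\mathcal I_C=\{\operatorname{Hom}_R(C,I)\mid I\text{ injective}\}$. An augmented proper $\mathcal P_C$-projective resolution of $M$ is a complex $X^+=\cdots\to C\otimes_RP_1\to C\otimes_RP_0\to M\to0$ with all $P_i$ projective such that $\operatorname{Hom}_R(C\otimes_RQ,X^+)$ is exact for every projective $R$-module $Q$ ($X^+$ itself need not be exact); the truncated complex $X=\cdots\to C\otimes_RP_1\to C\otimes_RP_0\to0$ is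 a proper $\mathcal P_C$-projective resolution of $M$. Such resolutions always exist. Put $\mathcal P_C\text{-}\operatorname{pd}(M)=\inf\{\sup X\mid X \text{ a proper }\mathcal P_C\text{-projective resolution of }M\}$, where $\sup X=\sup\{n\mid X_n\ne0\}$, and $\mathcal P_C\text{-}\operatorname{pd}(0)=-\infty$. $\mathcal F_C\text{-}\operatorname{pd}(M)$ is defined in the same way with flat modules in place of projective modules. Dually, an augmented proper $\mathcal I_C$-injective resolution of $M$ is a complex $Y^+=0\to M\to\operatorname{Hom}_R(C,I^0)\to\operatorname{Hom}_R(C,I^1)\to\cdots$ with all $I^i$ injective such that $\operatorname{Hom}_R(Y^+,\operatorname{Hom}_R(C,I))$ is exact for every injective $R$-module $I$, and $\mathcal I_C\text{-}\operatorname{id}(M)$ is the infimum, over all such, of $\sup\{n\mid\operatorname{Hom}_R(C,I^n)\neq0\}$. *)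

(* Defs.v *)
From HB Require Import structures.
From mathcomp Require Import all_boot all_order all_algebra.
From mathcomp Require Import all_classical.
From mathcomp Require Import constructive_ereal.

Set Implicit Arguments.
Unset Strict Implicit.
Unset Printing Implicit Defensive.

Import GRing.Theory.
Local Open Scope classical_set_scope.
Local Open Scope ring_scope.

Section LinearMaps.
Context {R : comPzRingType}.
Implicit Types U V W : lmodType R.

Definition Lin U V (f : U -> V) (lin_f : linear f) : {linear U -> V} :=
  HB.pack f (GRing.isLinear.Build R U V *:%R f lin_f).

Lemma linear_eq U V (f g : {linear U -> V}) : f =1 g -> f = g.
Proof.
case: f g => [f [+ +]] [g [+ +]] /= /funext fg; rewrite -{}fg => -[a] [b] [a'] [b'].
by rewrite (Prop_irrelevance a a') (Prop_irrelevance b b').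
Qed.

Definition isomorphic U V : Prop := exists f : {linear U -> V}, bijective f.

Definition exact_at (T : Type) V W (f : T -> V) (g : V -> W) : Prop :=
  range f = g @^-1` [set 0].

End LinearMaps.

(* Hom_R(U, V) with its pointwise module structure *)
Definition HomR (R : comPzRingType) (U V : lmodType R) : Type := {linear U -> V}.

Section Hom.
Context {R : comPzRingType}.
Implicit Types U V W : lmodType R.

Section Structure.
Context {U V : lmodType R}.
Implicit Types f g h : HomR U V.

HB.instance Definition _ := gen_eqMixin (HomR U V).
HB.instance Definition _ := gen_choiceMixin (HomR U V).

Definition hom_fun f : U -> V := (f : {linear U -> V}).

Lemma hom_eq f g : hom_fun f =1 hom_fun g -> f = g.
Proof. exact: linear_eq. Qed.

Lemma hom_zero_linear : linear (fun _ : U => 0 : V).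
Proof. by move=> a u v; rewrite scaler0 addr0. Qed.

Lemma hom_opp_linear f : linear (fun u => - hom_fun f u).
Proof. by move=> a u v; rewrite /hom_fun linearP opprD scalerN. Qed.

Lemma hom_add_linear f g : linear (fun u => hom_fun f u + hom_fun g u).
Proof. by move=> a u v; rewrite /hom_fun !linearP scalerDr addrACA. Qed.

Lemma hom_scale_linear (r : R) f : linear (fun u => r *: hom_fun f u).
Proof.
by move=> a u v; rewrite /hom_fun linearP scalerDr !scalerA [r * a]mulrC.
Qed.

Definition hom_zero : HomR U V := Lin hom_zero_linear.
Definition hom_opp f : HomR U V := Lin (hom_opp_linear f).
Definition hom_add f g : HomR U V := Lin (hom_add_linear f g).
Definition hom_scale r f : HomR U V := Lin (hom_scale_linear r f).

Lemma hom_addA : associative hom_add.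
Proof. by move=> f g h; apply: hom_eq => u; exact: addrA. Qed.
Lemma hom_addC : commutative hom_add.
Proof. by move=> f g; apply: hom_eq => u; exact: addrC. Qed.
Lemma hom_add0 : left_id hom_zero hom_add.
Proof. by move=> f; apply: hom_eq => u; exact: add0r. Qed.
Lemma hom_addN : left_inverse hom_zero hom_opp hom_add.
Proof. by move=> f; apply: hom_eq => u; exact: addNr. Qed.

HB.instance Definition _ :=
  GRing.isZmodule.Build (HomR U V) hom_addA hom_addC hom_add0 hom_addN.

Lemma hom_scaleA a b f : hom_scale a (hom_scale b f) = hom_scale (a * b) f.
Proof. by apply: hom_eq => u; exact: scalerA. Qed.
Lemma hom_scale1 : left_id 1 hom_scale.
Proof. by move=> f; apply: hom_eq => u; exact: scale1r. Qed.
Lemma hom_scaleDr : right_distributive hom_scale +%R.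
Proof. by move=> a f g; apply: hom_eq => u; exact: scalerDr. Qed.
Lemma hom_scaleDl f : {morph hom_scale^~ f : a b / a + b}.
Proof. by move=> a b; apply: hom_eq => u; exact: scalerDl. Qed.

HB.instance Definition _ := GRing.Zmodule_isLmodule.Build R (HomR U V)
  hom_scaleA hom_scale1 hom_scaleDr hom_scaleDl.

End Structure.

Definition hom_comp U V W (g : {linear V -> W}) (f : {linear U -> V}) :
  HomR U W := (g \o f : {linear U -> W}).

Lemma postcomp_linear U V W (g : {linear V -> W}) :
  linear (fun f : HomR U V => hom_comp g f).
Proof. by move=> a f f'; apply: hom_eq => u; exact: linearP. Qed.

Lemma precomp_linear U V W (f : {linear U -> V}) :
  linear (fun g : HomR V W => hom_comp g f).
Proof. by move=> a g g'; apply: hom_eq. Qed.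

(* Hom(U, g) and Hom(f, W) *)
Definition postcomp U V W (g : {linear V -> W}) :
  {linear HomR U V -> HomR U W} := Lin (@postcomp_linear U V W g).
Definition precomp U V W (f : {linear U -> V}) :
  {linear HomR V W -> HomR U W} := Lin (@precomp_linear U V W f).

End Hom.

Section Tensor.
Context {R : comPzRingType}.
Implicit Types U V W : lmodType R.

Definition is_bilinear U V W (b : U -> V -> W) : Prop :=
  (forall v, linear (b^~ v)) /\ (forall u, linear (b u)).

Section Construction.
Context {U V : lmodType R}.

(* The list [:: (u1, v1); ...; (un, vn)] stands for u1 (x) v1 + ... + un (x) vn.
   Two lists are identified when no bilinear map separates them; see
   tensor_univ for the universal property. *)
Definition tensor_eval W (b : U -> V -> W) (s : seq (U * V)) : W :=
  \sum_(p <- s) b p.1 p.2.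

Definition tensor_rel (s t : seq (U * V)) : bool :=
  `[< forall W (b : U -> V -> W), is_bilinear b -> tensor_eval b s = tensor_eval b t >].

Lemma tensor_rel_refl : reflexive tensor_rel.
Proof. by move=> s; apply/asboolP. Qed.
Lemma tensor_rel_sym : ssrbool.symmetric tensor_rel.
Proof.
by move=> s t; apply/asboolP/asboolP => st W b bl; apply/esym; exact: st.
Qed.
Lemma tensor_rel_trans : ssrbool.transitive tensor_rel.
Proof.
move=> t s u /asboolP st /asboolP tu; apply/asboolP => W b bl.
by rewrite (st W b bl); exact: tu.
Qed.

Canonical tensor_equiv :=
  EquivRel tensor_rel tensor_rel_refl tensor_rel_sym tensor_rel_trans.

End Construction.

Definition tensor U V : Type := {eq_quot @tensor_equiv U V}%qT.

Section Structure.
Context {U V : lmodType R}.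
Local Notation T := (tensor U V).
Local Open Scope quotient_scope.

HB.instance Definition _ := Choice.on T.
HB.instance Definition _ := EqQuotient.on T.

Lemma tensor_piP (s t : seq (U * V)) :
  (forall W (b : U -> V -> W), is_bilinear b -> tensor_eval b s = tensor_eval b t) <->
  \pi_T s = \pi_T t.
Proof.
split=> [st|/eqmodP/asboolP//].
by apply/eqmodP/asboolP.
Qed.

Lemma tensor_eval_repr W (b : U -> V -> W) s : is_bilinear b ->
  tensor_eval b (repr (\pi_T s)) = tensor_eval b s.
Proof. by move=> bl; apply: (tensor_piP _ _).2 => //; rewrite reprK. Qed.

Lemma tensor_eval_cat W (b : U -> V -> W) s t :
  tensor_eval b (s ++ t) = tensor_eval b s + tensor_eval b t.
Proof. exact: big_cat. Qed.

Definition lscale (r : R) (s : seq (U * V)) := [seq (r *: p.1, p.2) | p <- s].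

Lemma tensor_eval_scale W (b : U -> V -> W) r s : is_bilinear b ->
  tensor_eval b (lscale r s) = r *: tensor_eval b s.
Proof.
move=> [bl _]; rewrite /tensor_eval big_map scaler_sumr; apply: eq_bigr => p _ /=.
exact: (linearZ_LR (Lin (bl p.2))).
Qed.

Definition tensor_zero : T := \pi_T [::].
Definition tensor_add (s t : T) : T := \pi_T (repr s ++ repr t).
Definition tensor_scale (r : R) (s : T) : T := \pi_T (lscale r (repr s)).
Definition tensor_opp (s : T) : T := tensor_scale (-1) s.

Definition tensor_lift W (b : U -> V -> W) (s : T) : W := tensor_eval b (repr s).

Lemma tensor_ext (s t : T) :
  (forall W (b : U -> V -> W), is_bilinear b -> tensor_lift b s = tensor_lift b t) ->
  s = t.
Proof. by move=> st; rewrite -[s]reprK -[t]reprK; apply/tensor_piP. Qed.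

Section Lift.
Context {W : lmodType R} (b : U -> V -> W) (bl : is_bilinear b).

Lemma tensor_lift0 : tensor_lift b tensor_zero = 0.
Proof. by rewrite /tensor_lift tensor_eval_repr// /tensor_eval big_nil. Qed.
Lemma tensor_liftD s t :
  tensor_lift b (tensor_add s t) = tensor_lift b s + tensor_lift b t.
Proof. by rewrite /tensor_lift tensor_eval_repr// tensor_eval_cat. Qed.
Lemma tensor_liftZ r s : tensor_lift b (tensor_scale r s) = r *: tensor_lift b s.
Proof. by rewrite /tensor_lift tensor_eval_repr// tensor_eval_scale. Qed.

End Lift.

Let tensor_liftE := (@tensor_lift0, @tensor_liftD, @tensor_liftZ).

Lemma tensor_addA : associative tensor_add.
Proof. by move=> s t u; apply: tensor_ext => W b bl; rewrite !tensor_liftE// addrA. Qed.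
Lemma tensor_addC : commutative tensor_add.
Proof. by move=> s t; apply: tensor_ext => W b bl; rewrite !tensor_liftE// addrC. Qed.
Lemma tensor_add0 : left_id tensor_zero tensor_add.
Proof. by move=> s; apply: tensor_ext => W b bl; rewrite !tensor_liftE// add0r. Qed.
Lemma tensor_addN : left_inverse tensor_zero tensor_opp tensor_add.
Proof.
by move=> s; apply: tensor_ext => W b bl; rewrite !tensor_liftE// scaleN1r addNr.
Qed.

HB.instance Definition _ :=
  GRing.isZmodule.Build T tensor_addA tensor_addC tensor_add0 tensor_addN.

Lemma tensor_scaleA a c s : tensor_scale a (tensor_scale c s) = tensor_scale (a * c) s.
Proof. by apply: tensor_ext => W b bl; rewrite !tensor_liftE// scalerA. Qed.
Lemma tensor_scale1 : left_id 1 tensor_scale.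
Proof. by move=> s; apply: tensor_ext => W b bl; rewrite !tensor_liftE// scale1r. Qed.
Lemma tensor_scaleDr : right_distributive tensor_scale +%R.
Proof.
by move=> a s t; apply: tensor_ext => W b bl; rewrite !tensor_liftE// scalerDr.
Qed.
Lemma tensor_scaleDl s : {morph tensor_scale^~ s : a c / a + c}.
Proof.
by move=> a c; apply: tensor_ext => W b bl; rewrite !tensor_liftE// scalerDl.
Qed.

HB.instance Definition _ := GRing.Zmodule_isLmodule.Build R T
  tensor_scaleA tensor_scale1 tensor_scaleDr tensor_scaleDl.

Definition pure (u : U) (v : V) : T := \pi_T [:: (u, v)].

Lemma tensor_lift_pure W (b : U -> V -> W) u v : is_bilinear b ->
  tensor_lift b (pure u v) = b u v.
Proof. by move=> bl; rewrite /tensor_lift tensor_eval_repr// /tensor_eval big_seq1. Qed.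

Lemma tensor_lift_linear W (b : U -> V -> W) : is_bilinear b -> linear (tensor_lift b).
Proof. by move=> bl a s t; rewrite tensor_liftD// tensor_liftZ. Qed.

Lemma pure_bilinear : is_bilinear pure.
Proof.
split=> [v|u] a x y; apply: tensor_ext => W b bl;
  rewrite tensor_liftD// tensor_liftZ// !tensor_lift_pure//.
- exact: bl.1.
- exact: bl.2.
Qed.

Lemma tensor_sum_pure (s : T) : s = \sum_(p <- repr s) pure p.1 p.2.
Proof.
apply: tensor_ext => W b bl.
have := raddf_sum (Lin (tensor_lift_linear bl)) (repr s) xpredT
  (fun p => pure p.1 p.2).
by move=> /= ->; apply: eq_bigr => p _; rewrite tensor_lift_pure.
Qed.

Lemma tensor_univ W (b : U -> V -> W) : is_bilinear b ->
  exists! f : {linear T -> W}, forall u v, f (pure u v) = b u v.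
Proof.
move=> bl; exists (Lin (tensor_lift_linear bl)); split=> [u v|f fb] /=.
  exact: tensor_lift_pure.
apply: linear_eq => s; rewrite [in LHS](tensor_sum_pure s) [in RHS](tensor_sum_pure s).
rewrite !raddf_sum; apply: eq_bigr => p _.
by rewrite /= tensor_lift_pure//; exact: fb.
Qed.

End Structure.

Lemma tensor_map_bilinear U U' V (f : {linear U -> U'}) :
  is_bilinear (fun (u : U) (v : V) => pure (f u) v).
Proof.
have [pl pr] := @pure_bilinear U' V.
by split=> [v a x y|u a x y]; [rewrite linearP; exact: pl|exact: pr].
Qed.

(* f (x) V *)
Definition tensor_map U U' V (f : {linear U -> U'}) :
  {linear tensor U V -> tensor U' V} :=
  Lin (tensor_lift_linear (@tensor_map_bilinear U U' V f)).

End Tensor.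

Section ModuleClasses.
Context {R : comPzRingType}.
Implicit Types M N P U V : lmodType R.

Definition fg_submodule M (N : set M) : Prop :=
  exists s : seq M, N = [set m | exists a : nat -> R, m = \sum_(i < size s) a i *: s`_i].

Definition finite_module M : Prop := fg_submodule [set: M].

Definition is_submodule M (N : set M) : Prop :=
  N 0 /\ forall (a : R) u v, N u -> N v -> N (a *: u + v).

Definition projective P : Prop :=
  forall U V (g : {linear U -> V}) (f : {linear P -> V}), range g = setT ->
    exists h : {linear P -> U}, g \o h =1 f.

Definition injective_module N : Prop :=
  forall U V (g : {linear U -> V}) (f : {linear U -> N}), injective g ->
    exists h : {linear V -> N}, h \o g =1 f.

Definition flat N : Prop :=
  forall U V (f : {linear U -> V}), injective f -> injective (@tensor_map R U V N f).

End ModuleClasses.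

Definition noetherian (R : comPzRingType) : Prop :=
  forall I : set R^o, is_submodule I -> fg_submodule I.

Section Complexes.
Context {R : comPzRingType}.
Implicit Types M N U V : lmodType R.

(* ... -> X_1 -> X_0 -> M -> 0 *)
Record lcomplex M := LComplex {
  lterm :> nat -> lmodType R;
  ldiff : forall n, {linear lterm n.+1 -> lterm n};
  laug : {linear lterm 0%N -> M};
  ldiffK : forall n x, ldiff n (ldiff n.+1 x) = 0;
  laugK : forall x, laug (ldiff 0%N x) = 0 }.

(* 0 -> M -> Y^0 -> Y^1 -> ... *)
Record rcomplex M := RComplex {
  rterm :> nat -> lmodType R;
  rdiff : forall n, {linear rterm n -> rterm n.+1};
  raug : {linear M -> rterm 0%N};
  rdiffK : forall n x, rdiff n.+1 (rdiff n x) = 0;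
  raugK : forall x, rdiff 0%N (raug x) = 0 }.

(* exactness of the augmented complex, at M included *)
Definition lexact M (X : lcomplex M) : Prop :=
  [/\ range (laug X) = setT, exact_at (ldiff X 0%N) (laug X)
    & forall n, exact_at (ldiff X n.+1) (ldiff X n)].

Lemma postcompK U V V' V'' (f : {linear V -> V'}) (g : {linear V' -> V''}) :
  (forall v, g (f v) = 0) -> forall h, postcomp U g (postcomp U f h) = 0.
Proof. by move=> gf h; apply: hom_eq => u; exact: gf. Qed.

Lemma precompK U V V' V'' (f : {linear V -> V'}) (g : {linear V' -> V''}) :
  (forall v, g (f v) = 0) -> forall h, precomp U f (precomp U g h) = 0.
Proof.
by move=> gf h; apply: hom_eq => v; rewrite /hom_fun /= gf linear0.
Qed.

(* Hom(U, X^+) *)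
Definition hom_to_lcomplex M U (X : lcomplex M) : lcomplex (HomR U M) :=
  @LComplex (HomR U M) (fun n => HomR U (X n))
    (fun n => postcomp U (ldiff X n)) (postcomp U (laug X))
    (fun n => postcompK (@ldiffK M X n)) (postcompK (@laugK M X)).

(* Hom(Y^+, V) *)
Definition hom_from_rcomplex M V (Y : rcomplex M) : lcomplex (HomR M V) :=
  @LComplex (HomR M V) (fun n => HomR (Y n) V)
    (fun n => precomp V (rdiff Y n)) (precomp V (raug Y))
    (fun n => precompK (@rdiffK M Y n)) (precompK (@raugK M Y)).

(* sup {n | X_n <> 0}, which is -oo when all the terms are zero *)
Definition complex_sup (X : nat -> lmodType R) : \bar int :=
  supremum -oo%E [set (n%:Z)%:E | n in [set n | exists x : X n, x <> 0]].

End Complexes.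

Section Ext.
Context {R : comPzRingType}.
Implicit Types M N : lmodType R.

Definition projective_resolution M (X : lcomplex M) : Prop :=
  (forall n, projective (X n)) /\ lexact X.

(* Ext^i(M, N) = H^i(Hom(X, N)), where the choice of the projective
   resolution X of M is immaterial. *)
Definition Ext_eq0 (i : nat) M N : Prop :=
  forall X : lcomplex M, projective_resolution X ->
    match i with
    | 0 => injective (precomp N (ldiff X 0%N))
    | j.+1 => exact_at (precomp N (ldiff X j)) (precomp N (ldiff X j.+1))
    end.

Lemma homothety_linear M (r : R) : linear (fun m : M => r *: m).
Proof. by move=> a u v; rewrite scalerDr !scalerA [r * a]mulrC. Qed.

Definition homothety M (r : R) : HomR M M := Lin (@homothety_linear M r).

Definition semidualizing (C : lmodType R) : Prop :=
  [/\ finite_module C, bijective (homothety C)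
    & forall i, (0 < i)%N -> Ext_eq0 i C C].

End Ext.

Section RelativeDimensions.
Context {R : comPzRingType}.
Implicit Types C M : lmodType R.

(* P_C, F_C and I_C (up to isomorphism) are tensor_class projective C,
   tensor_class flat C and hom_class injective_module C. *)
Definition tensor_class (cls : lmodType R -> Prop) C (X : lmodType R) : Prop :=
  exists P, cls P /\ isomorphic X (tensor C P).

Definition hom_class (cls : lmodType R -> Prop) C (Y : lmodType R) : Prop :=
  exists I, cls I /\ isomorphic Y (HomR C I).

Definition proper_tensor_resolution (cls : lmodType R -> Prop) C M
    (X : lcomplex M) : Prop :=
  (forall n, tensor_class cls C (X n)) /\
  (forall Q, cls Q -> lexact (hom_to_lcomplex (tensor C Q) X)).

Definition proper_hom_resolution (cls : lmodType R -> Prop) C M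
    (Y : rcomplex M) : Prop :=
  (forall n, hom_class cls C (Y n)) /\
  (forall I, cls I -> lexact (hom_from_rcomplex (HomR C I) Y)).

Definition PC_pd C M : \bar int :=
  infimum +oo%E [set s | exists X : lcomplex M,
    proper_tensor_resolution projective C X /\ s = complex_sup X].

Definition FC_pd C M : \bar int :=
  infimum +oo%E [set s | exists X : lcomplex M,
    proper_tensor_resolution flat C X /\ s = complex_sup X].

Definition IC_id C M : \bar int :=
  infimum +oo%E [set s | exists Y : rcomplex M,
    proper_hom_resolution injective_module C Y /\ s = complex_sup Y].

Definition exact_zero_divisors (x y : R) M : Prop :=
  [/\ range ( *:%R x : M -> M) <> [set 0], range ( *:%R x : M -> M) <> setT,
      exact_at ( *:%R x : M -> M) ( *:%R y : M -> M)
    & exact_at ( *:%R y : M -> M) ( *:%R x : M -> M)].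

End RelativeDimensions.

(* Main.v *)
(* Choose a resolution of C by finite free modules; its differentials are
   matrices N_0, N_1, ..., and Ext^i(C, V) is the cohomology of the complex of
   tuples V^(s_0) -> V^(s_1) -> ... on which the N_k act. Being semidualizing
   thus makes (N_k, N_(k+1)) act exactly on C for all k, and (x, y), (y, x) are
   exact pairs of 1 x 1 matrices on C. If I is injective, an exact pair (A, B)
   on C is carried by Hom(-, I) to the exact pair (B^T, A^T) on Hom(C, I), and
   exactness is reflected when I is the injective cogenerator
   E = Hom_Z(R, Q/Z). As Hom(P, E) is injective for P projective or flat,
   Hom(C (x) P, E) = Hom(C, Hom(P, E)) shows that any exact pair on C is exact
   on C (x) P.

   Now let X be a bounded complex over M whose terms have all these exact pairs,
   with Hom(C, X^+) exact. Descending along X, each module of boundaries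
   inherits the exact pairs, being a quotient of a term by the previous
   boundaries, and homomorphisms from C to cycles / boundaries lift to cycles;
   so Hom(C, cycles / boundaries) = 0. The maximal minors of N_0 annihilate C,
   hence vanish since C is faithful, and McCoy's theorem yields
   cycles = boundaries. At the end of the complex M itself inherits the exact
   pairs (x, y), (y, x).

   A proper I_C-resolution Y of M is reduced to this case by X = Hom(Y, E),
   since Hom(Y, Hom(C, E)) = Hom(C, Hom(Y, E)). *)
Require Import Defs.
From HB Require Import structures.
From mathcomp Require Import all_boot all_order all_algebra.
From mathcomp Require Import all_classical.
From mathcomp Require Import constructive_ereal.

Set Implicit Arguments.
Unset Strict Implicit.
Unset Printing Implicit Defensive.

Import Order.TTheory GRing.Theory Num.Theory.
Local Open Scope classical_set_scope.
Local Open Scope ring_scope.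

(** * Matrices acting on tuples of module elements *)

Section TupleAction.
Context {R : comPzRingType}.
Implicit Types U V W : lmodType R.

Definition mxact V m n (A : 'M[R]_(m, n)) (v : 'I_n -> V) : 'I_m -> V :=
  fun i => \sum_j A i j *: v j.

Lemma mxact_linear V m n (A : 'M[R]_(m, n)) : linear (@mxact V m n A).
Proof.
move=> a u v; apply/funext => i.
rewrite -[RHS]/(a *: (\sum_j A i j *: u j) + \sum_j A i j *: v j).
rewrite scaler_sumr -big_split; apply: eq_bigr => j _.
by rewrite -[(_ + _) j]/(a *: u j + v j) scalerDr !scalerA mulrC.
Qed.

Lemma mxact0 V m n (A : 'M[R]_(m, n)) : mxact A (0 : 'I_n -> V) = 0.
Proof. exact: linear0 (Lin (@mxact_linear V m n A)). Qed.

Lemma mxactB V m n (A : 'M[R]_(m, n)) (u v : 'I_n -> V) :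
  mxact A (u - v) = mxact A u - mxact A v.
Proof. exact: linearB (Lin (@mxact_linear V m n A)) u v. Qed.

Lemma mxact_mul V m n p (A : 'M[R]_(m, n)) (B : 'M[R]_(n, p)) (v : 'I_p -> V) :
  mxact (A *m B) v = mxact A (mxact B v).
Proof.
apply/funext => i; rewrite /mxact.
under [RHS]eq_bigr do rewrite scaler_sumr.
rewrite exchange_big /=; apply: eq_bigr => k _; rewrite mxE scaler_suml.
by apply: eq_bigr => j _; rewrite scalerA.
Qed.

Lemma mxact0l V m n (v : 'I_n -> V) : mxact (0 : 'M[R]_(m, n)) v = 0.
Proof. by apply/funext => i; apply: big1 => j _; rewrite mxE scale0r. Qed.

Lemma mxact_map V W (f : {linear V -> W}) m n (A : 'M[R]_(m, n)) (v : 'I_n -> V) :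
  mxact A (f \o v) = f \o mxact A v.
Proof.
by apply/funext => i /=; rewrite linear_sum; apply: eq_bigr => j _; rewrite linearZ.
Qed.

(* Exactness at the middle term of the sequence S^a -> S^b -> S^c given by the
   matrices A and B, where S is a submodule of V. *)
Definition exact_on V (S : set V) a b c (A : 'M[R]_(b, a)) (B : 'M[R]_(c, b)) :=
  forall v, (forall i, S (v i)) -> mxact B v = 0 ->
    exists2 w, (forall j, S (w j)) & mxact A w = v.

Lemma exact_on_bij V W (f : {linear V -> W}) a b c
    (A : 'M[R]_(b, a)) (B : 'M[R]_(c, b)) :
  bijective f -> exact_on [set: W] A B -> exact_on [set: V] A B.
Proof.
move=> /[dup] /bij_inj fI [g fK gK] exW v _ Bv0.
have [|w _ Aw] := exW (f \o v) (fun=> I).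
  by rewrite mxact_map Bv0; apply/funext => i; exact: linear0.
exists (g \o w) => //; apply/funext => i; apply: fI.
rewrite -[f _]/((f \o _) i) -mxact_map -[RHS]/((f \o v) i) -Aw.
by congr (mxact A _ i); apply/funext => j; exact: gK.
Qed.

(** Lift [u] to [v] in [V]. Then [B v] lies in the kernel of [d] and is killed by [D], so it equals
    [B w] with [w] in that kernel; [v - w] is in the image of [A] and still lifts [u]. *)
Lemma exact_on_range V W (d : {linear V -> W}) m n p q
    (A : 'M[R]_(n, m)) (B : 'M[R]_(p, n)) (D : 'M[R]_(q, p)) :
  D *m B = 0 -> exact_on [set: V] A B -> exact_on (d @^-1` [set 0]) B D ->
  exact_on (range d) A B.
Proof.
move=> DB0 exV exK u /(_ _)/cid2-/all_sig2[v _ dv] Bu0.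
have duv : d \o v = u by apply/funext.
have [i||w wK Bw] := exK (mxact B v).
- by rewrite /= -[d _]/((d \o _) i) -mxact_map duv Bu0.
- by rewrite -mxact_mul DB0 mxact0l.
have [||t _ At] := exV (v - w) => //.
  by rewrite mxactB Bw subrr.
exists (d \o t) => [j|]; first by exists (t j).
rewrite mxact_map At -duv; apply/funext => i /=.
by rewrite linearB [d (w i)]wK subr0.
Qed.

Definition delta_tuple V n (i : 'I_n) (u : V) : 'I_n -> V :=
  fun j => if j == i then u else 0.

Lemma delta_tuple_linear V n (i : 'I_n) : linear (@delta_tuple V n i).
Proof.
move=> a u v; apply/funext => j.
rewrite -[RHS]/(a *: delta_tuple i u j + delta_tuple i v j) /delta_tuple.
by case: eqP => // _; rewrite scaler0 addr0.
Qed.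

Lemma delta_tupleZ V n (i : 'I_n) a (u : V) :
  delta_tuple i (a *: u) = a *: delta_tuple i u.
Proof. exact: linearZ_LR (Lin (@delta_tuple_linear V n i)) a u. Qed.

Lemma tuple_sum_delta V n (v : 'I_n -> V) : v = \sum_i delta_tuple i (v i).
Proof.
apply/funext => j; rewrite fct_sumE (bigD1 j)//= /delta_tuple eqxx big1 ?addr0//.
by move=> i /negPf; rewrite eq_sym => ->.
Qed.

Lemma mxact_delta V m n (A : 'M[R]_(m, n)) i (u : V) :
  mxact A (delta_tuple i u) = fun k => A k i *: u.
Proof.
apply/funext => k; rewrite /mxact (bigD1 i)//= /delta_tuple eqxx big1 ?addr0//.
by move=> j /negPf ->; rewrite scaler0.
Qed.

End TupleAction.

(** * Images of linear maps as modules *)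

Section Image.
Context {R : comPzRingType} {U V : lmodType R} (g : {linear U -> V}).

Definition image_pred : {pred V} := fun v => `[< range g v >].

Lemma image_pred_closed : submod_closed image_pred.
Proof.
split; first by apply/asboolP; exists 0; rewrite ?linear0.
move=> a _ _ /asboolP[u _ <-] /asboolP[v _ <-].
by apply/asboolP; exists (a *: u + v); rewrite ?linearP.
Qed.

HB.instance Definition _ := GRing.isSubmodClosed.Build R V image_pred
  image_pred_closed.

Record image_module :=
  ImageModule { image_val :> V; image_valP : image_val \in image_pred }.

HB.instance Definition _ := [isSub for image_val].
HB.instance Definition _ := [Choice of image_module by <:].
HB.instance Definition _ := [SubChoice_isSubLmodule of image_module by <:].

Lemma image_val_linear : linear image_val.
Proof. by []. Qed.

End Image.

(** * Injective modules, duality and adjunctions *)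

Section Injectives.
Context {R : comPzRingType}.
Implicit Types U V W C P I E : lmodType R.

(** Such an [f] descends to the image of [g], and injectivity extends it along the inclusion of that
    image in [V]. *)
Lemma injective_factor I U V (g : {linear U -> V}) (f : {linear U -> I}) :
  injective_module I -> (forall u, g u = 0 -> f u = 0) ->
  exists h : {linear V -> I}, h \o g =1 f.
Proof.
move=> injI kgf.
have img (t : image_module g) : {u | g u = t :> V}.
  by apply: cid; have /asboolP[u _ gu] := image_valP t; exists u.
pose f' (t : image_module g) : I := f (sval (img t)).
have f'E u t : g u = image_val t -> f u = f' t.
  move=> gu; apply/eqP; rewrite -subr_eq0 -linearB kgf//.
  by rewrite linearB gu (svalP (img t)) subrr.
have f'_linear : linear f'.
  move=> a s t; rewrite -[RHS]linearP; apply/esym/f'E.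
  by rewrite linearP !(svalP (img _)).
have [h hf] := injI _ _ (Lin (@image_val_linear _ _ _ g)) (Lin f'_linear) val_inj.
exists h => u.
have gu : g u \in image_pred g by apply/asboolP; exists u.
have /= -> := hf (ImageModule gu).
by apply/esym/f'E.
Qed.

Lemma hom_eval_linear U V (u : U) : linear (fun f : HomR U V => hom_fun f u).
Proof. by []. Qed.

Lemma mxact_hom U V m n (A : 'M[R]_(m, n)) (f : 'I_n -> HomR U V) i u :
  hom_fun (mxact A f i) u = \sum_j A i j *: hom_fun (f j) u.
Proof. exact: (congr1 (@^~ i) (esym (mxact_map (Lin (@hom_eval_linear U V u)) A f))). Qed.

(** A tuple [phi] over [HomR C E] is a single map [Phi : C^b -> E]. If [A^T] kills [phi], then [Phi]
    kills the image of [A], hence the kernel of [B], so it factors through [B]; the components of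
    the factor form [psi]. *)
Lemma exact_on_hom C E a b c (A : 'M[R]_(b, a)) (B : 'M[R]_(c, b)) :
  injective_module E -> exact_on [set: C] A B ->
  exact_on [set: HomR C E] B^T A^T.
Proof.
move=> injE exC phi _ Aphi0.
have Phi_linear : linear (fun v : 'I_b -> C => \sum_i hom_fun (phi i) (v i)).
  move=> r u v; rewrite scaler_sumr -big_split; apply: eq_bigr => i _.
  exact: linearP.
pose Phi := Lin Phi_linear.
have [v Bv0|Psi PsiB] := @injective_factor E _ _ (Lin (@mxact_linear R C _ _ B)) Phi injE.
  have [//|w _ <-] := exC v _ Bv0.
  rewrite /= /mxact; under eq_bigr do rewrite /hom_fun linear_sum.
  rewrite exchange_big big1//= => j _.
  transitivity (hom_fun (mxact A^T phi j) (w j)); last by rewrite Aphi0.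
  by rewrite mxact_hom; apply: eq_bigr => i _; rewrite linearZ mxE.
pose psi k : HomR C E :=
  (Psi \o Lin (@delta_tuple_linear R C _ k) : {linear C -> E}).
exists psi => //; apply/funext => i; apply: hom_eq => u.
rewrite mxact_hom; transitivity (Phi (delta_tuple i u)).
  rewrite -PsiB /= mxact_delta [X in Psi X]tuple_sum_delta linear_sum.
  apply: eq_bigr => k _; rewrite mxE /psi /hom_fun /= -linearZ_LR.
  by congr (Psi _); rewrite -delta_tupleZ.
rewrite /= (bigD1 i)//= {1}/delta_tuple eqxx big1 ?addr0// => j /negPf ji.
by rewrite /delta_tuple ji /hom_fun linear0.
Qed.

(** Separating [u] from a submodule [S] stands for a functional on the quotient by [S], which need
    not be constructed. *)
Definition cogenerator E : Prop :=
  forall U (S : set U) u, is_submodule S -> ~ S u ->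
  exists2 f : {linear U -> E}, (forall s, S s -> f s = 0) & f u <> 0.

(** A functional vanishing on the image of [A] but not at [v] has components killed by [A^T], so
    they come from some [psi] under [B^T]; its value at [v] is then [psi] applied to [B v = 0]. *)
Lemma exact_on_hom_inv W a b c (A : 'M[R]_(b, a)) (B : 'M[R]_(c, b)) E :
  cogenerator E ->
  exact_on [set: HomR W E] B^T A^T -> exact_on [set: W] A B.
Proof.
move=> sepE exWE v _ Bv0; apply: contrapT => Av.
have imA : is_submodule (range (@mxact _ W _ _ A)).
  split; first by exists 0; rewrite ?mxact0.
  move=> r _ _ [s _ <-] [t _ <-]; exists (r *: s + t) => //.
  exact: mxact_linear.
have [|f fA fv] := sepE _ _ v imA.
  by case=> w _ Aw; apply: Av; exists w.
pose phi k : HomR W E :=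
  (f \o Lin (@delta_tuple_linear R W _ k) : {linear W -> E}).
have fE u : f u = \sum_i hom_fun (phi i) (u i).
  by rewrite [in LHS](tuple_sum_delta u) linear_sum.
have [//||psi _ Bpsi] := exWE phi.
  apply/funext => j; apply: hom_eq => w; rewrite mxact_hom.
  transitivity (f (mxact A (delta_tuple j w))); last by apply: fA; exists (delta_tuple j w).
  rewrite fE mxact_delta; apply: eq_bigr => i _; rewrite mxE /hom_fun.
  by rewrite linearZ.
apply: fv; rewrite fE -Bpsi; under eq_bigr do rewrite mxact_hom.
rewrite exchange_big big1//= => k _.
transitivity (hom_fun (psi k) (mxact B v k)).
  by rewrite /mxact /hom_fun linear_sum; apply: eq_bigr => i _; rewrite mxE linearZ.
by rewrite Bv0 /hom_fun linear0.
Qed.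

Lemma curry_linear_in U V W (t : HomR (tensor U V) W) (u : U) :
  linear (fun v => hom_fun t (pure u v)).
Proof. by move=> a x y; rewrite (pure_bilinear.2 _) /hom_fun linearP. Qed.

Lemma curry_linear_out U V W (t : HomR (tensor U V) W) :
  linear (fun u => Lin (curry_linear_in t u) : HomR V W).
Proof.
by move=> a x y; apply: hom_eq => v; rewrite /hom_fun /= (pure_bilinear.1 _) /hom_fun linearP.
Qed.

Definition curry U V W (t : HomR (tensor U V) W) : HomR U (HomR V W) :=
  Lin (curry_linear_out t).

Lemma curry_linear U V W : linear (@curry U V W).
Proof. by move=> a s t; apply: hom_eq => u; apply: hom_eq => v. Qed.

Lemma uncurry_bilinear U V W (f : HomR U (HomR V W)) :
  is_bilinear (fun u v => hom_fun (hom_fun f u) v).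
Proof.
by split=> [v|u] a x y; [rewrite /hom_fun (linearP f)|rewrite /hom_fun linearP].
Qed.

Definition uncurry U V W (f : HomR U (HomR V W)) : HomR (tensor U V) W :=
  Lin (tensor_lift_linear (uncurry_bilinear f)).

Lemma uncurryK U V W : cancel (@uncurry U V W) (@curry U V W).
Proof.
move=> f; apply: hom_eq => u; apply: hom_eq => v.
exact: (tensor_lift_pure _ _ (uncurry_bilinear f)).
Qed.

Lemma tensor_hom_eq U V W (s t : HomR (tensor U V) W) :
  (forall u v, hom_fun s (pure u v) = hom_fun t (pure u v)) -> s = t.
Proof.
move=> st; apply: hom_eq => z; rewrite (tensor_sum_pure z) /hom_fun !linear_sum.
by apply: eq_bigr => p _; exact: st.
Qed.

Lemma curryK U V W : cancel (@curry U V W) (@uncurry U V W).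
Proof.
move=> t; apply: tensor_hom_eq => u v.
exact: (tensor_lift_pure _ _ (uncurry_bilinear (curry t))).
Qed.

Lemma swap_linear_in U V W (f : HomR U (HomR V W)) (v : V) :
  linear (fun u => hom_fun (hom_fun f u) v).
Proof. by move=> a x y; rewrite /hom_fun (linearP f). Qed.

Lemma swap_linear_out U V W (f : HomR U (HomR V W)) :
  linear (fun v => Lin (swap_linear_in f v) : HomR U W).
Proof. by move=> a x y; apply: hom_eq => u; rewrite /hom_fun /= /hom_fun linearP. Qed.

Definition swap U V W (f : HomR U (HomR V W)) : HomR V (HomR U W) :=
  Lin (swap_linear_out f).

Lemma swap_linear U V W : linear (@swap U V W).
Proof. by move=> a f g; apply: hom_eq => v; apply: hom_eq => u. Qed.

Lemma swapK U V W : cancel (@swap U V W) (@swap V U W).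
Proof. by move=> f; apply: hom_eq => u; apply: hom_eq => v. Qed.

(** By adjunction, extending [U -> Hom(P, E)] along [g] amounts to extending [U (x) P -> E] along
    the injection [g (x) P]. *)
Lemma injective_hom_flat P E :
  flat P -> injective_module E -> injective_module (HomR P E).
Proof.
move=> flatP injE U V g f gI.
have [h hg] := injE _ _ (tensor_map P g) (uncurry f) (flatP _ _ g gI).
exists (curry h) => u; apply: hom_eq => p.
have := hg (pure u p); rewrite /= !tensor_lift_pure//.
- exact: uncurry_bilinear.
- exact: tensor_map_bilinear.
Qed.

(** [Hom(V, E) -> Hom(U, E)] is onto. Swapping arguments turns [f] into a map from [P] to its
    target, and a lift of that map swaps back to an extension of [f]. *)
Lemma injective_hom_projective P E :
  projective P -> injective_module E -> injective_module (HomR P E).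
Proof.
move=> projP injE U V g f gI.
have [|h hg] := projP _ _ (precomp E g) (swap f).
  apply/seteqP; split => // k _; have [h hg] := injE _ _ g k gI.
  by exists h => //; apply: hom_eq.
exists (swap h) => u; apply: hom_eq => p.
exact: (congr1 (fun k => hom_fun k u) (hg p)).
Qed.

Lemma exact_on_tensor C P E a b c (A : 'M[R]_(b, a)) (B : 'M[R]_(c, b)) :
  injective_module (HomR P E) ->
  cogenerator E ->
  exact_on [set: C] A B -> exact_on [set: tensor C P] A B.
Proof.
move=> injPE sepE exC; apply: exact_on_hom_inv sepE _.
apply: (@exact_on_bij _ _ _ (Lin (@curry_linear C P E))); last exact: exact_on_hom.
by exists (@uncurry C P E); [exact: curryK|exact: uncurryK].
Qed.

End Injectives.

(** * The divisible group Q/Z and extension of characters *)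

Section Characters.

Definition int_closed : zmodClosed rat :=
  GRing.ZmodClosed.clone rat (@Num.int_num_subdef rat) _.

Definition rat_mod_int : zmodType := Quotient.quot int_closed.
Local Notation D := rat_mod_int.

Definition rat_class (q : rat) : D := (\pi_(Quotient.quot int_closed) q)%qT.

Lemma rat_class_additive : {morph rat_class : p q / p - q}.
Proof. exact: (raddfB (\pi_(Quotient.quot int_closed))%qT). Qed.

HB.instance Definition _ := GRing.isZmodMorphism.Build rat D rat_class rat_class_additive.

Lemma rat_class_eq0 (q : rat) : rat_class q = 0 -> q \is a Num.int.
Proof.
rewrite -[0](raddf0 rat_class) => /eqP.
by rewrite /rat_class -Quotient.idealrBE subr0.
Qed.

Lemma rat_class_int (n : int) : rat_class n%:~R = 0.
Proof.
rewrite -[0](raddf0 rat_class); apply/eqP; rewrite -Quotient.idealrBE subr0.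
exact: Num.Theory.intr_int.
Qed.

Lemma rat_mod_int_divisible (n : int) (g : D) : n != 0 -> exists d, d *~ n = g.
Proof.
move=> n0; exists (rat_class (repr g / n%:~R)%qT).
rewrite -raddfMz -mulrzl mulrC divfK ?intr_eq0//.
exact: (reprK g).
Qed.

(** The class of [1/n] works for [n > 1]; for [n = 0] any nonzero element does, here the class of
    [1/2]. *)
Lemma rat_mod_int_torsion (n : nat) : n != 1%N -> exists2 d : D, d != 0 & d *+ n = 0.
Proof.
have inv_nint (m : nat) : (1 < m)%N -> rat_class m%:R^-1 != 0.
  move=> m1; apply/eqP => /rat_class_eq0 /intrP[k mk].
  have m0 : m%:R != 0 :> rat by rewrite pnatr_eq0 -lt0n ltnW.
  have : (m%:Z * k)%:~R = 1%:~R :> rat by rewrite intrM -mk mulfV.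
  move=> /intr_inj /(congr1 absz); rewrite abszM /= => /eqP.
  by rewrite muln_eq1 => /andP[/eqP m_1 _]; rewrite m_1 in m1.
case: n => [|[|n]] // _; first by exists (rat_class 2%:R^-1) => //; exact: inv_nint.
exists (rat_class n.+2%:R^-1); first exact: inv_nint.
rewrite -raddfMn -[_^-1 *+ _]mulr_natr mulVf ?pnatr_eq0//.
exact: (rat_class_int 1).
Qed.

(** The generator is the least positive element of [H], or [0] when there is none. *)
Lemma int_subgroup (H : set int) : H 0 -> (forall a b, H a -> H b -> H (a - b)) ->
  exists n : nat, forall k, H k <-> (n %| k)%Z.
Proof.
move=> H0 HB.
have HN a : H a -> H (- a) by move=> Ha; rewrite -[- a]add0r; exact: HB.
have HMn a (m : nat) : H a -> H (a *+ m).
  move=> Ha; elim: m => [|m IHm]; first by rewrite mulr0n.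
  by rewrite mulrS -[a *+ m]opprK; apply: HB => //; exact: HN.
have HMz a (m : int) : H a -> H (a *~ m).
  by move=> Ha; case: m => m; [exact: HMn|exact/HN/HMn].
have Habs a : H a -> H `|a|%N.
  by move=> Ha; rewrite abszE; case: ger0P => // _; exact: HN.
have [[k0 k0H]|Hn0] := pselect (exists k : nat, `[< (0 < k)%N /\ H k%:Z >]).
- case: (ex_minnP (ex_intro (fun k : nat => `[< (0 < k)%N /\ H k%:Z >]) k0 k0H)).
  move=> n /asboolP[n0 Hn] n_min; exists n => k; split=> [Hk|/dvdzP[q ->]].
    have Hm : H (k %% n)%Z.
      have -> : (k %% n)%Z = k - n%:Z *~ (k %/ n)%Z.
        by rewrite {2}(divz_eq k n) mulrzz [n%:Z * _]mulrC addrAC subrr add0r.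
      by apply: HB => //; exact: HMz.
    have n0' : n%:Z != 0 by rewrite -lt0n.
    apply/dvdz_mod0P; move: (modz_ge0 k n0') (ltz_pmod k (n0 : 0 < n%:Z)) Hm.
    case: (k %% n)%Z => // r _ r_n Hr; apply: contrapT => /eqP r0.
    have : (n <= r)%N by apply: n_min; apply/asboolP; rewrite lt0n.
    by rewrite leqNgt; apply/negP; rewrite negbK -ltz_nat.
  by rewrite mulrC -mulrzz; exact: HMz.
exists 0%N => k; rewrite dvd0z; split=> [Hk|/eqP->//].
rewrite -absz_eq0; apply: contrapT => /negP k_n0; apply: Hn0.
by exists `|k|%N; apply/asboolP; split; [rewrite lt0n|exact: Habs].
Qed.

Section Extension.
Context {V : zmodType}.
Implicit Types (G : set (V * D)) (v : V) (d : D).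

(* The graph of an additive map from a subgroup of V to D. *)
Definition partial_char G : Prop :=
  [/\ G 0, forall p q, G p -> G q -> G (p - q) & forall d, G (0, d) -> d = 0].

Lemma partial_charMz G p (k : int) : partial_char G -> G p -> G (p *~ k).
Proof.
move=> [G0 GB _] Gp.
have GN q : G q -> G (- q) by move=> Gq; rewrite -[- q]add0r; exact: GB.
have GMn (m : nat) : G (p *+ m).
  elim: m => [|m IHm]; first by rewrite mulr0n.
  by rewrite mulrS -[p *+ m]opprK; apply: GB => //; exact: GN.
by case: k => m; [exact: GMn|exact/GN/GMn].
Qed.

(** The graph of the extension of [G] to the subgroup generated by its domain and [v], with value
    [d] at [v]. *)
Definition add_value G v d : set (V * D) :=
  [set p | exists2 k : int, exists2 u, G u & p = u + (v, d) *~ k & True].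

Lemma pairMz v d (k : int) : (v, d) *~ k = (v *~ k, d *~ k).
Proof.
by rewrite [LHS]surjective_pairing; congr pair; [rewrite (raddfMz fst)|rewrite (raddfMz snd)].
Qed.

Lemma partial_char_add_value G v d : partial_char G ->
  (forall k g, G (v *~ k, g) -> g = d *~ k) -> partial_char (add_value G v d).
Proof.
move=> /[dup] gG [G0 GB Gf] dG; split.
- by exists 0 => //; exists 0 => //; rewrite mulr0z addr0.
- move=> _ _ [k [u Gu ->] _] [l [w Gw ->] _]; exists (k - l) => //.
  by exists (u - w); [exact: GB|rewrite mulrzBr opprD addrACA].
- move=> e [k [[w g] Gu]]; rewrite pairMz => -[/esym/eqP].
  rewrite addr_eq0 => /eqP wE -> _; rewrite wE -mulrNz in Gu.
  by rewrite (dG _ _ Gu) mulrNz addNr.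
Qed.

(** The multiples of [v] in the domain of [G] are those by multiples of some [n]. For [n <> 0],
    divisibility of Q/Z lets the value at [n v] be divided by [n]; for [n = 0] every [d] is
    consistent. *)
Lemma partial_char_value G v : partial_char G ->
  exists d, forall k g, G (v *~ k, g) -> g = d *~ k.
Proof.
move=> /[dup] gG [G0 GB Gf].
have Gfun u g h : G (u, g) -> G (u, h) -> g = h.
  move=> Gg Gh; apply/eqP; rewrite -subr_eq0; apply/eqP/Gf.
  by rewrite -(subrr u); exact: (GB _ _ Gg Gh).
have [||n Hn] := @int_subgroup [set k | exists g, G (v *~ k, g)].
- by exists 0; rewrite mulr0z.
- move=> a b [g Gg] [h Gh]; exists (g - h); rewrite mulrzBr.
  exact: (GB _ _ Gg Gh).
have [n0|n0] := eqVneq n%:Z 0.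
  exists 0 => k g Gg; rewrite mul0rz.
  have /Hn : (exists g, G (v *~ k, g)) by exists g.
  rewrite n0 dvd0z => /eqP k0.
  by rewrite k0 mulr0z in Gg; exact: Gf.
have [g0 Gg0] : exists g, G (v *~ n%:Z, g) by apply/Hn; exact: dvdzz.
have [d dn] := rat_mod_int_divisible g0 n0.
exists d => k g Gg.
have /Hn/dvdzP[m kE] : (exists g, G (v *~ k, g)) by exists g.
apply: (Gfun (v *~ k)) => //; rewrite kE mulrC !mulrzA dn -pairMz.
exact: partial_charMz.
Qed.

Lemma partial_char_extend G : partial_char G ->
  exists chi : {additive V -> D}, forall p, G p -> chi p.1 = p.2.
Proof.
move=> gG; have [G0 GB Gf] := gG.
(* Zorn's lemma is applied to the sets whose union with [G] is a partial character, so that the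
   empty chain, whose union is empty, qualifies. *)
have [|A [gA Amax]] := @Zorn_bigcup _ [set H | partial_char (H `|` G)].
  move=> F FP Ftot; split.
  - by right.
  - have FU X p q : F X -> (X `|` G) p -> (X `|` G) q ->
        (\bigcup_(X in F) X `|` G) (p - q).
      move=> FX Xp Xq; have [_ XB _] := FP _ FX.
      by have [?|?] := XB _ _ Xp Xq; [left; exists X|right].
    move=> p q [[X FX Xp]|Gp] [[Y FY Yq]|Gq].
    + have [XY|YX] := Ftot _ _ FX FY.
        by apply: (FU Y) => //; left=> //; exact: XY.
      by apply: (FU X) => //; left=> //; exact: YX.
    + by apply: (FU X) => //; [left|right].
    + by apply: (FU Y) => //; [right|left].
    + by right; exact: GB.
  - move=> d [[X FX Xd]|Gd]; last exact: Gf.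
    by have [_ _] := FP _ FX; apply; left.
have [A0 AB Af] := gA.
have Atotal v : exists d, (A `|` G) (v, d).
  have [d dA] := partial_char_value v gA.
  have gA' := partial_char_add_value gA dA.
  set A' := add_value _ _ _ in gA'.
  have AA' : A `|` G `<=` A'.
    by move=> p Ap; exists 0 => //; exists p => //; rewrite mulr0z addr0.
  (* Otherwise [A'], which takes the value [d] at [v], would strictly contain [A], against
     maximality. *)
  exists d; left; apply: contrapT => nAv.
  apply: (Amax A'); last first.
    suff A'G : A' `|` G = A' by rewrite /= A'G.
    by apply/seteqP; split=> [p [//|Gp]|p]; [apply: AA'; right|left].
  split; first by move=> p Ap; apply: AA'; left.
  move=> A'A; apply: nAv; apply: A'A.
  by exists 1 => //; exists 0 => //; rewrite mulr1z add0r.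
have [chi chiA] := choice Atotal.
have Afun u g h : (A `|` G) (u, g) -> (A `|` G) (u, h) -> g = h.
  move=> Gg Gh; apply/eqP; rewrite -subr_eq0; apply/eqP/Af.
  by rewrite -(subrr u); exact: (AB _ _ Gg Gh).
have chi_additive : zmod_morphism chi.
  by move=> u v; apply: (Afun (u - v)) => //; exact: (AB _ _ (chiA u) (chiA v)).
exists (HB.pack_for {additive V -> D} chi (GRing.isZmodMorphism.Build V D chi chi_additive)).
by move=> [v d] Gp; apply: (Afun v) => //; right.
Qed.

End Extension.
End Characters.

(** * The character module as an injective cogenerator *)

Section CharacterModule.
Context {R : comPzRingType}.
Local Notation D := rat_mod_int.

Definition char_pred : {pred (R -> D)} := fun f => `[< {morph f : r s / r - s} >].

Lemma char_pred_closed : zmod_closed char_pred.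
Proof.
split; first by apply/asboolP => r s; rewrite subrr.
move=> f g /asboolP fB /asboolP gB; apply/asboolP => r s.
by rewrite -[LHS]/(f (r - s) - g (r - s)) fB gB opprD addrACA -opprD.
Qed.

HB.instance Definition _ := GRing.isZmodClosed.Build (R -> D) char_pred
  char_pred_closed.

(* Hom_Z(R, Q/Z) *)
Record char_module := CharModule { char_fun : R -> D; char_funP : char_fun \in char_pred }.

HB.instance Definition _ := [isSub for char_fun].
HB.instance Definition _ := [Choice of char_module by <:].
HB.instance Definition _ := [SubChoice_isSubZmodule of char_module by <:].
Implicit Types f g : char_module.

Lemma char_funB f : {morph char_fun f : r s / r - s}.
Proof. exact/asboolP/(char_funP f). Qed.

Lemma char_eq f g : char_fun f =1 char_fun g -> f = g.
Proof. by move=> fg; apply/val_inj/funext. Qed.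

Lemma char_scaleP (a : R) f : (fun r => char_fun f (r * a)) \in char_pred.
Proof. by apply/asboolP => r s; rewrite mulrBl char_funB. Qed.

Definition char_scale a f := CharModule (char_scaleP a f).

Lemma char_scaleA a b f : char_scale a (char_scale b f) = char_scale (a * b) f.
Proof. by apply: char_eq => r /=; rewrite mulrA. Qed.
Lemma char_scale1 : left_id 1 char_scale.
Proof. by move=> f; apply: char_eq => r /=; rewrite mulr1. Qed.
Lemma char_scaleDr : right_distributive char_scale +%R.
Proof. by move=> a f g; apply: char_eq. Qed.
Lemma char_scaleDl f : {morph char_scale^~ f : a b / a + b}.
Proof.
move=> a b; apply: char_eq => r.
rewrite -[RHS]/(char_fun f (r * a) + char_fun f (r * b)) /= mulrDr.
by apply/eqP; rewrite -subr_eq -char_funB addrK.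
Qed.

HB.instance Definition _ := GRing.Zmodule_isLmodule.Build R char_module
  char_scaleA char_scale1 char_scaleDr char_scaleDl.

(** This is the adjunction between [Hom_Z(V, Q/Z)] and [Hom_R(V, Hom_Z(R, Q/Z))]; evaluation at [1]
    recovers [chi]. *)
Lemma char_lift_linear (V : lmodType R) (chi : {additive V -> D}) :
  exists f : {linear V -> char_module}, forall v r, char_fun (f v) r = chi (r *: v).
Proof.
have chiP v : (fun r => chi (r *: v)) \in char_pred.
  by apply/asboolP => r s; rewrite scalerBl raddfB.
have f_linear : linear (fun v => CharModule (chiP v)).
  move=> a u v; apply: char_eq => r /=.
  by rewrite scalerDr raddfD scalerA.
by exists (Lin f_linear).
Qed.

(** Evaluating [f] at [1] gives a character on the image of [g]; it extends to [V], and the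
    adjunction makes the extension linear. *)
Lemma char_module_injective : injective_module char_module.
Proof.
move=> U V g f gI.
have [|chi chiE] := @partial_char_extend V
  [set p | exists u, p = (g u, char_fun (f u) 1)].
  split.
  - by exists 0; rewrite !linear0.
  - by move=> _ _ [u ->] [w ->]; exists (u - w); rewrite !linearB.
  - by move=> d [u [/esym gu0 ->]]; rewrite (gI u 0) ?linear0.
have [h hE] := char_lift_linear chi; exists h => u; apply: char_eq => r /=.
rewrite hE -linearZ_LR (chiE (_, char_fun (f (r *: u)) 1)); last by exists (r *: u).
have frE : f (r *: u) = r *: f u by exact: linearZ_LR.
by rewrite [LHS]/= frE -[LHS]/(char_fun (f u) (1 * r)) mul1r.
Qed.

(** The integers [k] with [k u] in [S] are the multiples of some [n], and [n <> 1] as [u] is not in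
    [S]. A nonzero [d] with [n d = 0] gives a character of [S + Z u] that kills [S] and sends [u] to
    [d]. *)
Lemma char_module_cogenerator : cogenerator char_module.
Proof.
move=> U S u [S0 SD] nSu.
have SB a b : S a -> S b -> S (a - b).
  by move=> Sa Sb; rewrite addrC -scaleN1r; exact: SD.
have [||n Hn] := @int_subgroup [set k | S (u *~ k)].
- by rewrite /= mulr0z.
- by move=> a b Sa Sb; rewrite /= mulrzBr; exact: SB.
have [|d d0 dn] := @rat_mod_int_torsion n.
  by apply: contra_notN nSu => /eqP n1; rewrite -[u]mulr1z; apply/Hn; rewrite n1.
have [|chi chiE] := @partial_char_extend U
  [set p | exists2 k : int, exists2 s, S s & p = (s + u *~ k, d *~ k) & True].
  split.
  - by exists 0 => //; exists 0; rewrite // !mulr0z addr0.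
  - move=> _ _ [k [s Ss ->] _] [l [t St ->] _]; exists (k - l) => //.
    exists (s - t); first exact: SB.
    rewrite -[LHS]/(s + u *~ k - (t + u *~ l), d *~ k - d *~ l).
    by rewrite !mulrzBr opprD addrACA.
  - move=> e [k [s Ss [/esym/eqP]]]; rewrite addr_eq0 => /eqP suk -> _.
    have /Hn/dvdzP[m ->] : S (u *~ k).
      by rewrite -[u *~ k]opprK -suk -sub0r; exact: SB.
    by rewrite mulrC mulrzA -pmulrn dn mul0rz.
have [f fE] := char_lift_linear chi; exists f => [s Ss|fu0].
  apply: char_eq => r; rewrite fE (chiE (_, 0))//.
  exists 0 => //; exists (r *: s); last by rewrite !mulr0z addr0.
  by rewrite -[_ *: _]addr0; exact: SD.
have : char_fun (f u) 1 = d.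
  rewrite fE scale1r (chiE (_, d))//; exists 1 => //; exists 0 => //.
  by rewrite !mulr1z add0r.
by rewrite fu0 => /esym/eqP; rewrite (negPf d0).
Qed.

End CharacterModule.
Arguments char_module R : clear implicits.

(** * Free resolutions over a noetherian ring *)

Section FreeResolution.
Context {R : comPzRingType}.
Hypothesis noethR : noetherian R.

(** Induction on [n]: the first coordinates of [S] form a finitely generated ideal. The rows of [T]
    lift its generators, and the rows of [A], padded by a zero, generate the elements of [S] with
    first coordinate zero. *)
Lemma fg_row_submodule n (S : set 'rV[R]_n) : is_submodule S ->
  exists m (A : 'M[R]_(m, n)), forall u, S u <-> exists w, u = w *m A.
Proof.
elim: n S => [|n IHn] S [S0 SD].
  exists 0%N, 0 => u; rewrite [u]thinmx0; split=> // _.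
  by exists 0; rewrite mulmx0.
have SZ a u : S u -> S (a *: u) by move=> Su; rewrite -[_ *: _]addr0; exact: SD.
have SA u v : S u -> S v -> S (u + v).
  by move=> Su Sv; rewrite -[u]scale1r; exact: SD.
have [|b bI] := noethR (I := [set a | exists2 u : 'rV[R]_(1 + n), S u & u 0 0 = a]).
  split; first by exists 0; rewrite ?mxE.
  move=> a _ _ [u Su <-] [v Sv <-]; exists (a *: u + v); first exact: SD.
  by rewrite !mxE.
have [|m [A SE]] := IHn [set u | S (row_mx (0 : 'rV_1) u)].
  split; first by rewrite /= row_mx0.
  move=> a u v Su Sv /=.
  have -> : row_mx (0 : 'rV_1) (a *: u + v) = a *: row_mx 0 u + row_mx 0 v.
    by rewrite scale_row_mx add_row_mx scaler0 addr0.
  exact: SD.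
have lift (i : 'I_(size b)) : exists u : 'rV[R]_(1 + n), S u /\ u 0 0 = b`_i.
  have : [set a | exists2 u : 'rV[R]_(1 + n), S u & u 0 0 = a] b`_i.
    rewrite bI; exists (fun j => (j == i :> nat)%:R).
    rewrite (bigD1 i)//= eqxx scale1r big1 ?addr0// => j /negPf ji.
    by rewrite -val_eqE /= in ji; rewrite ji scale0r.
  by case=> u Su ub; exists u.
have [t /all_and2[St tb]] := choice lift.
pose T : 'M[R]_(size b, 1 + n) := \matrix_i t i.
have ST (w : 'rV_(size b)) : S (w *m T).
  rewrite mulmx_sum_row; elim/big_ind: _ => // i _.
  by apply: SZ; rewrite rowK.
pose B : 'M[R]_(size b + m, 1 + n) := col_mx T (row_mx 0 A).
suff SB (u : 'rV[R]_(1 + n)) : S u <-> exists w, u = w *m B.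
  by exists (size b + m)%N, B.
rewrite /B; split=> [Su|[w ->]].
  have : [set a | exists2 u : 'rV[R]_(1 + n), S u & u 0 0 = a] (u 0 0) by exists u.
  rewrite bI => -[a ub].
  pose w : 'rV_(size b) := \row_i a i.
  pose v : 'rV[R]_(1 + n) := u - w *m T.
  have Sv : S v by rewrite /v addrC -scaleN1r; apply: SD.
  have v0 : lsubmx v = 0.
    apply/rowP => i; rewrite ord1 mxE lshift0 mxE ub !mxE -sumrB big1// => j _.
    by rewrite !mxE tb subrr.
  have /SE[z vz] : [set u | S (row_mx (0 : 'rV_1) u)] (rsubmx v).
    by rewrite /= -v0 hsubmxK.
  exists (row_mx w z); rewrite mul_row_col mul_mx_row mulmx0 -vz -v0 hsubmxK.
  by rewrite addrC subrK.
rewrite -[w]hsubmxK mul_row_col mul_mx_row mulmx0; apply: SA => //.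
by have /SE : exists z, rsubmx w *m A = z *m A by exists (rsubmx w).
Qed.

Definition row_comb (V : lmodType R) n (c : 'I_n -> V) (u : 'rV[R]_n) : V :=
  \sum_i u 0 i *: c i.

Lemma row_comb_linear (V : lmodType R) n (c : 'I_n -> V) : linear (row_comb c).
Proof.
move=> a u v; rewrite /row_comb scaler_sumr -big_split; apply: eq_bigr => i _.
by rewrite !mxE scalerDl scalerA.
Qed.

Lemma row_combB (V : lmodType R) n (c : 'I_n -> V) u v :
  row_comb c (u - v) = row_comb c u - row_comb c v.
Proof. exact: linearB (Lin (row_comb_linear c)) u v. Qed.

Lemma row_comb_mul (V : lmodType R) m n (c : 'I_n -> V) (w : 'rV[R]_m) (A : 'M_(m, n)) :
  row_comb c (w *m A) = row_comb (mxact A c) w.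
Proof.
rewrite /row_comb /mxact; under [RHS]eq_bigr do rewrite scaler_sumr.
rewrite exchange_big; apply: eq_bigr => j _; rewrite mxE scaler_suml.
by apply: eq_bigr => i _; rewrite scalerA.
Qed.

Lemma row_comb_delta (V : lmodType R) n (c : 'I_n -> V) i :
  row_comb c (delta_mx 0 i) = c i.
Proof.
rewrite /row_comb (bigD1 i)//= mxE !eqxx scale1r big1 ?addr0// => j /negPf ji.
by rewrite mxE ji scale0r.
Qed.

Lemma row_comb_hom (V : lmodType R) n (f : {linear 'rV[R]_n -> V}) u :
  f u = row_comb (fun i => f (delta_mx 0 i)) u.
Proof.
rewrite [in LHS](row_sum_delta u) linear_sum; apply: eq_bigr => i _.
exact: linearZ_LR.
Qed.

Lemma projective_row n : projective ('rV[R]_n).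
Proof.
move=> U V g f g_onto.
have lift i : exists u, g u = f (delta_mx 0 i).
  have : range g (f (delta_mx 0 i)) by rewrite g_onto.
  by case=> u; exists u.
have [t gt] := choice lift.
exists (Lin (row_comb_linear t)) => u; rewrite [RHS]row_comb_hom /= linear_sum.
by apply: eq_bigr => i _; rewrite linearZ_LR gt.
Qed.

(** Bundling a matrix with its size lets the choice of syzygies be iterated although the sizes
    change. *)
Record mxwrap := MxWrap {
  wrap_rows : nat;
  wrap_cols : nat;
  wrap_mx : 'M[R]_(wrap_rows, wrap_cols) }.

(* The terms are R^(s k), on row vectors; N k is the differential R^(s k.+1) ->
   R^(s k), and the generators c define the augmentation R^(s 0) -> C. *)
Lemma free_resolution (C : lmodType R) : finite_module C ->
  exists (s : nat -> nat) (N : forall k, 'M[R]_(s k.+1, s k)) (c : 'I_(s 0%N) -> C),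
  [/\ forall z, exists u, z = row_comb c u,
      forall u : 'rV_(s 0%N), row_comb c u = 0 <-> exists w, u = w *m N 0%N
    & forall k (u : 'rV_(s k.+1)), u *m N k = 0 <-> exists w, u = w *m N k.+1].
Proof.
move=> [b bC].
pose c (i : 'I_(size b)) : C := b`_i.
have [|m [A AE]] := @fg_row_submodule _ [set u | row_comb c u = 0].
  split=> [|a u v /= cu cv]; first exact: linear0 (Lin (row_comb_linear c)).
  by rewrite row_comb_linear cu cv scaler0 addr0.
have syz (M : mxwrap) : {m & {B : 'M[R]_(m, wrap_rows M) |
    forall u : 'rV_(wrap_rows M), u *m wrap_mx M = 0 <-> exists w, u = w *m B}}.
  have [|m' /cid] := cid (@fg_row_submodule _ [set u | u *m wrap_mx M = 0] _).
    split=> [|a u v /= uM vM]; first by rewrite /= mul0mx.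
    by rewrite mulmxDl -scalemxAl uM vM scaler0 addr0.
  by case=> B BE; exists m', B; exact: BE.
pose next M := MxWrap (sval (projT2 (syz M))).
pose st k := iter k next (MxWrap A).
exists (fun k => wrap_cols (st k)), (fun k => wrap_mx (st k)), c; split=> //.
- move=> z; have : [set: C] z by [].
  rewrite bC => -[a ->]; exists (\row_i a i); apply: eq_bigr => i _.
  by rewrite mxE.
- by move=> k u; exact: (svalP (projT2 (syz (st k)))).
Qed.

End FreeResolution.

(** * Ext and Hom out of C in terms of matrices *)

Section ExtMatrices.
Context {R : comPzRingType}.

Lemma row_mul_linear m n (A : 'M[R]_(m, n)) : linear (fun u : 'rV_m => u *m A).
Proof. by move=> a u v; rewrite mulmxDl scalemxAl. Qed.

Context (C : lmodType R) (s : nat -> nat) (N : forall k, 'M[R]_(s k.+1, s k)).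
Context (c : 'I_(s 0%N) -> C).
Hypothesis c_gen : forall z, exists u, z = row_comb c u.
Hypothesis c_rel : forall u : 'rV_(s 0%N), row_comb c u = 0 <-> exists w, u = w *m N 0%N.
Hypothesis N_exact : forall k (u : 'rV_(s k.+1)),
  u *m N k = 0 <-> exists w, u = w *m N k.+1.

Lemma resolution_mul0 k : N k.+1 *m N k = 0.
Proof.
apply/row_matrixP => i; rewrite row_mul row0; apply/N_exact.
by exists (delta_mx 0 i); rewrite -rowE.
Qed.

Lemma resolution_augK (u : 'rV_(s 1%N)) : row_comb c (u *m N 0%N) = 0.
Proof. by apply/c_rel; exists u. Qed.

Lemma resolution_diffK k (u : 'rV_(s k.+2)) : u *m N k.+1 *m N k = 0.
Proof. by rewrite -mulmxA resolution_mul0 mulmx0. Qed.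

Definition free_lcomplex : lcomplex C :=
  @LComplex R C (fun k => 'rV[R]_(s k) : lmodType R)
    (fun k => Lin (row_mul_linear (N k))) (Lin (row_comb_linear c))
    resolution_diffK resolution_augK.

Lemma free_lcomplex_resolution : projective_resolution free_lcomplex.
Proof.
split=> [k|]; first exact: projective_row.
split=> [||k]; apply/seteqP; split=> // z /=.
- by move=> _; have [u ->] := c_gen z; exists u.
- by case=> w _ <-; exact: resolution_augK.
- by move=> /c_rel[w ->]; exists w.
- by case=> w _ <-; exact: resolution_diffK.
- by move=> /N_exact[w ->]; exists w.
Qed.

(** Maps from [R^(s k)] to [V] are tuples of values on the basis, and precomposition with the
    differential becomes the action of [N k]. *)
Lemma exact_on_Ext_eq0 (V : lmodType R) k :
  Ext_eq0 k.+1 C V -> exact_on [set: V] (N k) (N k.+1).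
Proof.
move=> /(_ _ free_lcomplex_resolution) ext v _ Nv0.
pose phi : HomR 'rV_(s k.+1) V := Lin (row_comb_linear v).
have : range (precomp V (ldiff free_lcomplex k)) phi.
  rewrite ext; apply: hom_eq => u.
  rewrite /hom_fun /= row_comb_mul Nv0 /row_comb big1// => i _.
  exact: scaler0.
case=> psi _ psi_phi; pose w j := hom_fun psi (delta_mx 0 j).
exists w => //; apply/funext => i.
rewrite -[RHS](row_comb_delta v) -[RHS]/(hom_fun phi (delta_mx 0 i)) -psi_phi.
rewrite -[RHS]/(hom_fun psi (delta_mx 0 i *m N k)) /hom_fun row_comb_hom.
by rewrite row_comb_mul row_comb_delta.
Qed.

Lemma mxact_gen (V : lmodType R) (f : {linear C -> V}) : mxact (N 0%N) (f \o c) = 0.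
Proof.
rewrite mxact_map; apply/funext => i /=.
have <- : row_comb c (row i (N 0%N)) = mxact (N 0%N) c i.
  by apply: eq_bigr => j _; rewrite mxE.
have -> : row_comb c (row i (N 0%N)) = 0.
  by apply/c_rel; exists (delta_mx 0 i); rewrite -rowE.
exact: linear0.
Qed.

(** With [mxact_gen], this identifies [Hom(C, V)] with the kernel of [N 0] on tuples. Each [z] is
    written in the generators by a chosen [t z]; the value is independent of this choice because [v]
    satisfies the relations of [C]. *)
Lemma hom_of_tuple (V : lmodType R) (v : 'I_(s 0%N) -> V) : mxact (N 0%N) v = 0 ->
  exists f : {linear C -> V}, f \o c = v.
Proof.
move=> Nv0; have [t tE] := choice c_gen.
have f_wd u w : row_comb c u = row_comb c w -> row_comb v u = row_comb v w.
  move=> uw; have : row_comb c (u - w) = 0.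
    by rewrite row_combB uw subrr.
  move=> /c_rel[z uwE]; apply/eqP.
  rewrite -subr_eq0 -row_combB uwE row_comb_mul Nv0.
  by rewrite /row_comb big1// => i _; exact: scaler0.
have f_linear : linear (fun z => row_comb v (t z)).
  move=> a z w; rewrite -row_comb_linear; apply: f_wd.
  by rewrite row_comb_linear -!tE.
exists (Lin f_linear); apply/funext => i /=.
by rewrite -[RHS](row_comb_delta v); apply: f_wd; rewrite -tE row_comb_delta.
Qed.

End ExtMatrices.

(** * McCoy's theorem and the determinant trick *)

Section McCoy.
Context {R : comPzRingType}.

(** Neither distinct rows nor sorted columns are asked for, so that the minors arising in [mccoy]
    need no normalization. *)
Definition maximal_minors_vanish m n (A : 'M[R]_(m, n)) : Prop :=
  forall (f : 'I_n -> 'I_m) (g : 'I_n -> 'I_n), injective g -> \det (mxsub f g A) = 0.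

Definition ord_cons r n (i : 'I_n) (f : 'I_r -> 'I_n) : 'I_r.+1 -> 'I_n :=
  fun k => if unlift ord0 k is Some k' then f k' else i.

(* McCoy's theorem modulo S: take a minor of maximal size r whose determinant
   does not map l into S, adjoin a column j, and let the coefficients be the
   cofactors of the adjoined row. *)
Lemma mccoy (V : lmodType R) (S : set V) (l : V) m n (A : 'M[R]_(m, n)) :
  is_submodule S -> maximal_minors_vanish A -> ~ S l ->
  exists2 a : 'I_n -> R, (forall i, S (mxact A (fun j => a j *: l) i)) &
    exists j, ~ S (a j *: l).
Proof.
move=> [S0 SD] A0 nSl.
pose P r := `[< exists (f : 'I_r -> 'I_m) (g : 'I_r -> 'I_n),
  injective g /\ ~ S (\det (mxsub f g A) *: l) >].
(* The empty minor is [1] and [l] is not in [S], so a maximal size exists. *)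
have P0 : P 0%N.
  have from0 p : 'I_0 -> 'I_p by case.
  by apply/asboolP; exists (from0 m), (from0 n); split=> [[]//|]; rewrite det_mx00 scale1r.
have Pn r : P r -> (r <= n)%N.
  by move=> /asboolP[f [g [/leq_card + _]]]; rewrite !card_ord.
case: (ex_maxnP (ex_intro P _ P0) Pn) => r /asboolP[f [g [gI nSd]]] r_max.
have r_n : (r < n)%N.
  rewrite ltn_neqAle Pn ?andbT; last by apply/asboolP; exists f, g.
  apply: contra_notN nSd => /eqP rn; subst r.
  by rewrite A0// scale0r.
have [j gj] : exists j, j \notin codom g.
  apply/existsP; rewrite -negb_forall; apply/negP => /forallP g_onto.
  have : (n <= r)%N.
    rewrite -[n]card_ord -[r]card_ord -(card_codom gI) eq_leq//.
    by apply: eq_card => z; rewrite g_onto.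
  by rewrite leqNgt r_n.
pose g' := ord_cons j g.
have g'I : injective g'.
  move=> k k'; rewrite /g' /ord_cons.
  case: unliftP => [i ->|->]; case: unliftP => [i' ->|->] //.
  - by move=> /gI ->.
  - by move=> gij; rewrite -gij codom_f in gj.
  - by move=> gij; rewrite gij codom_f in gj.
pose B i := mxsub (ord_cons i f) g' A.
(* By maximality of [r]; a row [i] already listed in [f] is covered too, since rows may repeat. *)
have SB i : S (\det (B i) *: l).
  apply: contrapT => nSB.
  suff : (r.+1 <= r)%N by rewrite ltnn.
  by apply: r_max; apply/asboolP; exists (ord_cons i f), g'.
(* The adjoined row is deleted in these cofactors, so they do not depend on [i]. *)
pose cof (k : 'I_r.+1) := (-1) ^+ k * \det (mxsub f (g' \o lift k) A).
have detB i : \det (B i) = \sum_k A i (g' k) * cof k.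
  rewrite (expand_det_row _ ord0); apply: eq_bigr => k _.
  rewrite mxE /ord_cons unlift_none; congr (_ * _).
  rewrite /cofactor add0n; congr (_ * \det _); apply/matrixP => p q.
  by rewrite !mxE /ord_cons liftK.
(* As [g'] is injective, each coordinate is a single cofactor, or [0] off the columns of [g']. At
   [j] it is the original minor, which does not send [l] into [S]. *)
exists (fun a => \sum_(k | g' k == a) cof k) => [i|].
  suff -> : mxact A (fun a => (\sum_(k | g' k == a) cof k) *: l) i = \det (B i) *: l.
    exact: SB.
  rewrite detB scaler_suml (partition_big g' xpredT)//=; apply: eq_bigr => a _.
  rewrite !scaler_suml scaler_sumr; apply: eq_bigr => k /eqP <-.
  by rewrite scalerA.
exists j; rewrite (bigD1 ord0) /=; last by rewrite /g' /ord_cons unlift_none.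
rewrite big1 ?addr0; last first.
  move=> k /andP[/eqP g'k k0]; have : g' k = g' ord0 by rewrite g'k /g' /ord_cons unlift_none.
  by move=> /g'I /eqP; rewrite (negPf k0).
rewrite /cof expr0 mul1r; have -> // : mxsub f (g' \o lift ord0) A = mxsub f g A.
by apply/matrixP => p q; rewrite !mxE /g' /= /ord_cons liftK.
Qed.

(** The adjugate of [B] times [B] is the scalar matrix of the determinant, and [B] kills [c]. *)
Lemma det_kills_gen (V : lmodType R) n (B : 'M[R]_n) (c : 'I_n -> V) i :
  mxact B c = 0 -> \det B *: c i = 0.
Proof.
move=> Bc0; transitivity (mxact (\det B)%:M c i).
  rewrite /mxact (bigD1 i)//= mxE eqxx big1 ?addr0// => j /negPf ji.
  by rewrite mxE eq_sym ji scale0r.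
by rewrite -mul_adj_mx mxact_mul Bc0 mxact0.
Qed.

Lemma faithful_minors_vanish (C : lmodType R) m n (c : 'I_n -> C) (A : 'M[R]_(m, n)) :
  (forall z, exists u, z = row_comb c u) -> injective (homothety C) ->
  mxact A c = 0 -> maximal_minors_vanish A.
Proof.
move=> c_gen homI Ac0 f g gI; apply: homI; apply: hom_eq => z.
rewrite /hom_fun /= scale0r.
(* Permuting the generators by [g] along with the columns turns the rows [f] of the relation into
   relations for the square submatrix. *)
have Bc0 : mxact (mxsub f g A) (c \o g) = 0.
  apply/funext => i; transitivity (mxact A c (f i)); last by rewrite Ac0.
  rewrite /mxact [RHS](reindex g); last exact/onW_bij/injF_bij.
  by apply: eq_bigr => k _; rewrite mxE.
have [u ->] := c_gen z; rewrite scaler_sumr big1// => j _.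
have [h _ hK] := injF_bij gI.
by rewrite scalerA mulrC -scalerA -[j in c j]hK (det_kills_gen _ Bc0) scaler0.
Qed.
End McCoy.

(** * Descent along a bounded complex *)

Section Devissage.
Context {R : comPzRingType}.
Context (C : lmodType R) (s : nat -> nat) (N : forall k, 'M[R]_(s k.+1, s k)).
Context (c : 'I_(s 0%N) -> C).
Hypothesis c_gen : forall z, exists u, z = row_comb c u.
Hypothesis c_rel : forall u : 'rV_(s 0%N), row_comb c u = 0 <-> exists w, u = w *m N 0%N.
Hypothesis NK : forall k, N k.+1 *m N k = 0.
Hypothesis N_minors : maximal_minors_vanish (N 0%N).

Context (T : nat -> lmodType R) (d : forall n, {linear T n.+1 -> T n}).

(** Degree [0] will hold the resolved module, which has no further differential, so every element
    there is a cycle. *)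
Definition cycles n : set (T n) :=
  match n with 0%N => setT | m.+1 => d m @^-1` [set 0] end.

Hypothesis d_cycles : forall n z, cycles (d n z).
Hypothesis T_exact : forall n k, exact_on [set: T n.+1] (N k) (N k.+1).
Hypothesis T_bounded : exists b, forall n, (b <= n)%N -> forall z : T n, z = 0.
Hypothesis hom_exact : forall n (f : {linear C -> T n}), (forall z, cycles (f z)) ->
  exists g : {linear C -> T n.+1}, d n \o g =1 f.

Lemma range_submodule (U V : lmodType R) (f : {linear U -> V}) : is_submodule (range f).
Proof.
split; first by exists 0; rewrite ?linear0.
by move=> a _ _ [u _ <-] [v _ <-]; exists (a *: u + v); rewrite ?linearP.
Qed.

(* If a tuple is N 0-closed modulo the boundaries, then correcting it by
   boundaries makes it a homomorphism from C, which lifts along d; hence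
   Hom(C, cycles / boundaries) = 0, and McCoy's theorem applies. *)
Lemma cycles_range n : exact_on (range (d n)) (N 0%N) (N 1%N) ->
  cycles (n := n) = range (d n).
Proof.
move=> exB; apply/seteqP; split=> [l lZ|_ [z _ <-]]; last exact: d_cycles.
apply: contrapT => nBl.
have [a aB [j aj]] := mccoy (range_submodule (d n)) N_minors nBl.
(* [N 1] kills this tuple of boundaries, so it is [N 0] applied to a tuple [w] of boundaries. *)
have [|w wB Nw] := exB _ aB.
  by rewrite -mxact_mul NK mxact0l.
have [|f fc] := @hom_of_tuple _ _ _ N c c_gen c_rel _ ((fun j => a j *: l) - w).
  by rewrite mxactB Nw subrr.
(* The values of [f] are cycles, since it sends the generators to [a i *: l - w i]. *)
have [z|g dg] := hom_exact (f := f).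
  have cyc_sub : is_submodule (cycles (n := n)).
    case: (n) => [|m]; first by split.
    split; first by rewrite /= linear0.
    by move=> b u v /= u0 v0; rewrite linearP u0 v0 scaler0 addr0.
  have [cyc0 cycD] := cyc_sub.
  have [u ->] := c_gen z; rewrite /row_comb linear_sum.
  elim/big_ind: _ => // [x y xZ yZ|i _].
    by rewrite -[x]scale1r; exact: cycD.
  rewrite linearZ_LR -[_ *: _]addr0; apply: (cycD) => //.
  rewrite -[f _]/((f \o c) i) fc.
  have /= -> : ((fun j => a j *: l) - w) i = -1 *: w i + (a i *: l + 0).
    by rewrite scaleN1r addr0 addrC.
  have [t _ <-] := wB i.
  by apply: (cycD); [exact: d_cycles|exact: cycD].
(* Now [a j *: l] is the boundary of [g (c j)] plus the boundary [w j], against the choice of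
   [j]. *)
have [_ BD] := range_submodule (d n).
apply: aj; rewrite -[a j *: l](subrK (w j)) -[X in range _ (X + _)]scale1r.
apply: BD => //; exists (g (c j)) => //.
by rewrite [LHS]dg -[LHS]/((f \o c) j) fc.
Qed.

(** Above the bound, [Q] is trivial. Given [Q n.+1], the kernel of [d n] is the range of [d n.+1],
    so [exact_on_range] carries the exact pairs to the range of [d n]. Finally [Q 0] says that the
    range of [d 0] is all of [T 0]. *)
Lemma devissage (p : nat -> nat) (P : forall k, 'M[R]_(p k.+1, p k)) :
  (forall k, P k.+1 *m P k = 0) ->
  (forall n k, exact_on [set: T n.+1] (P k) (P k.+1)) ->
  forall k, exact_on [set: T 0%N] (P k) (P k.+1).
Proof.
move=> PK P_exact; have [b bT] := T_bounded.
pose Q n := [/\ cycles (n := n) = range (d n),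
    forall k, exact_on (range (d n)) (N k) (N k.+1)
  & forall k, exact_on (range (d n)) (P k) (P k.+1)].
have step n : Q n.+1 -> Q n.
  move=> [cycE BN BP].
  have BN' k : exact_on (range (d n)) (N k) (N k.+1).
    by apply: (exact_on_range (NK k.+1)) => //; rewrite [X in exact_on X]cycE.
  split=> // [|k]; first exact: cycles_range.
  by apply: (exact_on_range (PK k.+1)) => //; rewrite [X in exact_on X]cycE.
suff /(_ 0%N b (leqnn b))[cycE _ BP] k : forall m, (b <= k + m)%N -> Q k.
  by rewrite [setT]cycE.
move=> m; elim: m k => [|m IHm] n nb; last first.
  by apply/step/IHm; rewrite addSnnS.
have {}nb : (b <= n)%N by rewrite -[n]addn0.
have T0 := bT _ nb; split.
- apply/seteqP; split=> z _; last first.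
    by rewrite (T0 z) -(linear0 (d n)); exact: d_cycles.
  by rewrite (T0 z); exists 0; rewrite ?linear0.
- move=> k v _ _; exists 0 => [j|]; first by exists 0; rewrite ?linear0.
  by apply/funext => i; rewrite (T0 (v i)) (T0 (mxact _ _ _)).
- move=> k v _ _; exists 0 => [j|]; first by exists 0; rewrite ?linear0.
  by apply/funext => i; rewrite (T0 (v i)) (T0 (mxact _ _ _)).
Qed.
End Devissage.

(** * Finite dimension and bounded resolutions *)

Section BoundedComplexes.
Local Open Scope ereal_scope.

(** The empty set has infimum [+oo] by default, and if all elements are [+oo], so is the infimum. *)
Lemma infimum_lt_pinfty (A : set (\bar int)) :
  infimum +oo A < +oo -> exists2 t, A t & t < +oo.
Proof.
move=> A_lt; apply: contrapT => A_ge.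
have Ay t : A t -> t = +oo.
  move=> At; apply/eqP; rewrite -leye_eq leNgt; apply/negP => t_lt.
  by apply: A_ge; exists t.
suff AE : infimum +oo A = +oo by rewrite AE ltxx in A_lt.
rewrite /infimum; case: ifPn => // /set0P[t At].
apply: xget_subset1; last exact: is_subset1_infimums.
by split=> [u /Ay ->//|u _]; exact: leey.
Qed.

(** If nonzero terms occurred in arbitrarily high degrees, [+oo] would be the only upper bound of
    these degrees, hence their supremum. *)
Lemma complex_sup_lt_pinfty (R : comPzRingType) (X : nat -> lmodType R) :
  complex_sup X < +oo -> exists b, forall n, (b <= n)%N -> forall z : X n, z = 0%R.
Proof.
rewrite /complex_sup; set A := [set _ | _ in _] => A_lt.
apply: contrapT => unbounded.
have large b : exists2 n, (b <= n)%N & A (n%:Z)%:E.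
  apply: contrapT => small; apply: unbounded; exists b => n bn z.
  apply: contrapT => z0; apply: small; exists n => //.
  by exists n => //; exists z.
have supA : supremums A +oo.
  split=> [t _|t tA]; first exact: leey.
  case: t tA => [k||] tA //; last first.
    by have [n _ /tA] := large 0%N.
  have [n kn /tA] := large `|k|.+1%N.
  rewrite lee_fin => nk; exfalso.
  have : (`|k|%N%:Z < n%:Z)%R by rewrite ltz_nat.
  by rewrite ltNge (le_trans nk) // abszE ler_norm.
suff : supremum -oo A = +oo by move=> AE; rewrite AE ltxx in A_lt.
rewrite /supremum ifF; last first.
  by apply/negbTE/set0P; have [n _ An] := large 0%N; exists n%:Z%:E.
exact: xget_subset1 supA (@is_subset1_supremums _ _ A).
Qed.

End BoundedComplexes.

(** * Transport along isomorphisms and the regular module *)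

Section Transport.
Context {R : comPzRingType}.

Lemma exact_at_bij (U V W U' V' W' : lmodType R)
    (f : {linear U -> V}) (g : {linear V -> W})
    (f' : {linear U' -> V'}) (g' : {linear V' -> W'})
    (i : {linear U -> U'}) (j : {linear V -> V'}) (k : {linear W -> W'}) :
  bijective i -> bijective j -> bijective k ->
  (forall u, f' (i u) = j (f u)) -> (forall v, g' (j v) = k (g v)) ->
  exact_at f g -> exact_at f' g'.
Proof.
move=> [i' iK i'K] [j' jK j'K] /bij_inj kI fij gjk fg.
have gE v : range f v <-> g v = 0 by rewrite fg.
apply/seteqP; split=> [_ [u _ <-]|v' /= gv0].
  rewrite -[u]i'K fij /= gjk (_ : g _ = 0) ?linear0//.
  by apply/gE; exists (i' u).
have /gE[u _ fu] : g (j' v') = 0 by apply: kI; rewrite -gjk j'K linear0.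
by exists (i u) => //; rewrite fij fu j'K.
Qed.

Lemma lexact_bij (M M' : lmodType R) (X : lcomplex M) (X' : lcomplex M')
    (i : {linear M -> M'}) (j : forall n, {linear X n -> X' n}) :
  bijective i -> (forall n, bijective (j n)) ->
  (forall z, laug X' (j 0%N z) = i (laug X z)) ->
  (forall n z, ldiff X' n (j n.+1 z) = j n (ldiff X n z)) ->
  lexact X -> lexact X'.
Proof.
move=> ib jb aug_nat diff_nat [X0 X1 X2]; split.
- apply/seteqP; split=> // m _; have [i' iK i'K] := ib.
  have [z _ zm] : range (laug X) (i' m) by rewrite X0.
  by exists (j 0%N z) => //; rewrite aug_nat zm i'K.
- exact: (exact_at_bij (i := j 1%N) (j := j 0%N) (k := i)) X1.
- by move=> n; exact: (exact_at_bij (i := j n.+2) (j := j n.+1) (k := j n)) (X2 n).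
Qed.

Lemma precomp_bij (U U' V : lmodType R) (f : {linear U -> U'}) :
  bijective f -> bijective (precomp V f).
Proof.
move=> [g fK gK].
have g_linear : linear g.
  by move=> a u v; rewrite -[RHS]fK linearP !gK.
exists (precomp V (Lin g_linear)) => h; apply: hom_eq => u.
  by rewrite /hom_fun /= gK.
by rewrite /hom_fun /= fK.
Qed.

Lemma regular_map_bilinear (U : lmodType R) :
  is_bilinear (fun (u : U) (r : R^o) => r *: u).
Proof.
split=> [r|u] a v w; last by rewrite scalerDl scalerA.
by rewrite scalerDr !scalerA mulrC.
Qed.

Lemma tensor_regular_linear (U : lmodType R) :
  linear (fun u : U => pure u (1 : R^o)).
Proof. exact: (@pure_bilinear R U R^o).1. Qed.

(** Serves to read [Hom(C (x) R, X^+)] as [Hom(C, X^+)]. The inverse sends [u (x) r] to [r u]. *)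
Lemma tensor_regular_bij (U : lmodType R) :
  bijective (fun u : U => pure u (1 : R^o)).
Proof.
exists (tensor_lift (fun (u : U) (r : R^o) => r *: u)) => [u|t].
  by rewrite tensor_lift_pure ?scale1r//; exact: regular_map_bilinear.
pose f : HomR (tensor U R^o) (tensor U R^o) :=
  (Lin (@tensor_regular_linear U)
     \o Lin (tensor_lift_linear (@regular_map_bilinear U)) : {linear _ -> _}).
suff fE : f = (idfun : {linear tensor U R^o -> tensor U R^o}).
  exact: (congr1 (fun h => hom_fun h t) fE).
apply: tensor_hom_eq => u r; rewrite /hom_fun /= tensor_lift_pure; last exact: regular_map_bilinear.
have [pl pr] := @pure_bilinear R U R^o.
have /= pl1 := linearZ_LR (Lin (pl 1)) r u.
have /= pr1 := linearZ_LR (Lin (pr u)) r 1.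
by rewrite pl1 -pr1; congr pure; exact: mulr1.
Qed.

Lemma projective_regular : projective (R^o).
Proof.
move=> U V g f g_onto.
have [u _ gu] : range g (f 1) by rewrite g_onto.
have h_linear : linear (fun r : R^o => r *: u).
  by move=> a r t; rewrite scalerDl scalerA.
exists (Lin h_linear) => r /=.
rewrite linearZ_LR gu -linearZ_LR; congr (f _).
exact: mulr1.
Qed.

Lemma flat_regular : flat (R^o).
Proof.
move=> U V f fI s t.
have [g gK gK'] := tensor_regular_bij U; rewrite -[s]gK' -[t]gK'.
rewrite /= !tensor_lift_pure; try exact: tensor_map_bilinear.
by move=> /(bij_inj (tensor_regular_bij V))/fI ->.
Qed.

End Transport.

(** * Exact zero-divisors on the resolved module *)

Section ExactZeroDivisors.
Context {R : comPzRingType}.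
Local Notation "x %:m" := (x%:M : 'M[R]_1) (at level 2).

Lemma mxact_scalar (V : lmodType R) (x : R) (v : 'I_1 -> V) i :
  mxact x%:m v i = x *: v i.
Proof. by rewrite /mxact big_ord1 mxE ord1 eqxx. Qed.

(** [exact_on] only puts the kernel inside the image; [y * x = 0] gives the other inclusion. *)
Lemma exact_onP (V : lmodType R) (x y : R) : y * x = 0 ->
  exact_at ( *:%R x : V -> V) ( *:%R y : V -> V) <-> exact_on [set: V] x%:m y%:m.
Proof.
move=> yx0; split=> [xy v _ yv0|xy].
  have : range ( *:%R x : V -> V) (v ord0).
    by rewrite xy /= -(mxact_scalar y v) yv0.
  case=> w _ wv; exists (fun=> w) => //; apply/funext => i.
  by rewrite mxact_scalar wv [i]ord1.
apply/seteqP; split=> [_ [v _ <-]|v /= yv0]; first by rewrite /= scalerA yx0 scale0r.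
have [|w _ /(congr1 (@^~ ord0))] := xy (fun=> v) (fun=> I).
  by apply/funext => i; rewrite mxact_scalar yv0.
by rewrite mxact_scalar; exists (w ord0).
Qed.

(** All three dimensions reduce to this statement, where the resolution enters only through
    exactness of [Hom(C, X^+)], boundedness, and exact pairs inherited from [C]. *)
Lemma exact_on_resolved (C M : lmodType R) (x y : R) (X : lcomplex M) :
  noetherian R -> semidualizing C -> x * y = 0 ->
  exact_on [set: C] x%:m y%:m -> exact_on [set: C] y%:m x%:m ->
  lexact (hom_to_lcomplex C X) ->
  (exists b, forall n, (b <= n)%N -> forall z : X n, z = 0) ->
  (forall n a b c (A : 'M[R]_(b, a)) (B : 'M[R]_(c, b)),
    exact_on [set: C] A B -> exact_on [set: X n] A B) ->
  exact_on [set: M] x%:m y%:m /\ exact_on [set: M] y%:m x%:m.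
Proof.
move=> noethR [fgC /bij_inj homI ExtC] xy0 Cxy Cyx [homX homX0 homXS] [b Xb] X_exact.
have [s [N [c [c_gen c_rel N_exact]]]] := free_resolution noethR fgC.
have NK := resolution_mul0 N_exact.
have CN k : exact_on [set: C] (N k) (N k.+1).
  exact: (exact_on_Ext_eq0 c_gen c_rel N_exact (ExtC k.+1 isT)).
have N_minors : maximal_minors_vanish (N 0%N).
  exact: faithful_minors_vanish c_gen homI (mxact_gen c_rel idfun).
(* Shifting by one puts [M] in degree [0], with the augmentation as [d 0]. *)
pose T n := if n is m.+1 then X m else M.
pose d n : {linear T n.+1 -> T n} :=
  match n with 0%N => laug X | m.+1 => ldiff X m end.
have d_cycles n z : cycles d (d n z).
  by case: n z => [|[|n]] z //; [exact: laugK|exact: ldiffK].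
have T_bounded : exists b, forall n, (b <= n)%N -> forall z : T n, z = 0.
  by exists b.+1 => -[|n] // bn z; exact: Xb.
have hom_exact n (f : {linear C -> T n}) : (forall z, cycles d (f z)) ->
    exists g : {linear C -> T n.+1}, d n \o g =1 f.
  case: n f => [|[|n]] f fZ.
  - have [g _ gf] : range (laug (hom_to_lcomplex C X)) f by rewrite homX.
    by exists g => z; exact: (congr1 (fun h => hom_fun h z) gf).
  - have [g _ gf] : range (ldiff (hom_to_lcomplex C X) 0%N) f.
      by rewrite homX0; apply: hom_eq => z; exact: fZ.
    by exists g => z; exact: (congr1 (fun h => hom_fun h z) gf).
  - have [g _ gf] : range (ldiff (hom_to_lcomplex C X) n.+1) f.
      by rewrite homXS; apply: hom_eq => z; exact: fZ.
    by exists g => z; exact: (congr1 (fun h => hom_fun h z) gf).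
(* A periodic family alternating [x] and [y]: its pairs at [k = 0] and [k = 1] are the two
   wanted. *)
pose P k : 'M[R]_1 := (if odd k then y else x)%:M.
have PK k : P k.+1 *m P k = 0.
  rewrite /P -scalar_mxM /=; case: (odd k) => /=; last rewrite mulrC; rewrite xy0;
  by rewrite raddf0.
have CP k : exact_on [set: C] (P k) (P k.+1).
  by rewrite /P /=; case: (odd k).
have MP := devissage c_gen c_rel NK N_minors d_cycles
  (fun n k => X_exact n _ _ _ _ _ (CN k)) T_bounded hom_exact PK
  (fun n k => X_exact n _ _ _ _ _ (CP k)).
by split; [exact: (MP 0%N)|exact: (MP 1%N)].
Qed.

(** Treats projective and flat modules alike: [cls R^o] yields exactness of [Hom(C, X^+)], and
    injectivity of the duals passes exact pairs from [C] to the terms. *)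
Lemma exact_on_tensor_resolved (cls : lmodType R -> Prop) (C M : lmodType R)
    (x y : R) (X : lcomplex M) :
  cls R^o ->
  (forall P, cls P -> injective_module (HomR P (char_module R))) ->
  noetherian R -> semidualizing C -> x * y = 0 ->
  exact_on [set: C] x%:m y%:m -> exact_on [set: C] y%:m x%:m ->
  proper_tensor_resolution cls C X -> (complex_sup X < +oo)%E ->
  exact_on [set: M] x%:m y%:m /\ exact_on [set: M] y%:m x%:m.
Proof.
move=> clsR cls_inj noethR sdC xy0 Cxy Cyx [X_cls X_proper] /complex_sup_lt_pinfty X_bounded.
apply: (exact_on_resolved noethR sdC xy0 Cxy Cyx _ X_bounded).
  pose nu := Lin (@tensor_regular_linear R C).
  apply: (@lexact_bij _ _ _ (hom_to_lcomplex (tensor C R^o) X) (hom_to_lcomplex C X)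
    (precomp M nu) (fun n => precomp (X n) nu)) (X_proper _ clsR) => [||z|n z].
  - exact/precomp_bij/tensor_regular_bij.
  - by move=> n; exact/precomp_bij/tensor_regular_bij.
  - by apply: hom_eq.
  - by apply: hom_eq.
move=> n a b c A B CAB; have [P [clsP [f fb]]] := X_cls n.
apply: (exact_on_bij fb); apply: exact_on_tensor CAB; first exact: cls_inj.
exact: char_module_cogenerator.
Qed.

Lemma exact_on_hom_resolved (C M : lmodType R) (x y : R) (Y : rcomplex M) :
  noetherian R -> semidualizing C -> x * y = 0 ->
  exact_on [set: C] x%:m y%:m -> exact_on [set: C] y%:m x%:m ->
  proper_hom_resolution injective_module C Y -> (complex_sup Y < +oo)%E ->
  exact_on [set: M] x%:m y%:m /\ exact_on [set: M] y%:m x%:m.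
Proof.
move=> noethR sdC xy0 Cxy Cyx [Y_cls Y_proper] /complex_sup_lt_pinfty[b Yb].
pose E := char_module R.
have injE : injective_module E := @char_module_injective R.
pose X := hom_from_rcomplex E Y.
have [|||DMxy DMyx] := @exact_on_resolved C (HomR M E) x y X noethR sdC xy0 Cxy Cyx.
- have swap_bij U V : bijective (@swap R U V E) by exists (@swap R V U E); exact: swapK.
  apply: (@lexact_bij _ _ _ (hom_from_rcomplex (HomR C E) Y) (hom_to_lcomplex C X)
    (Lin (@swap_linear R M C E)) (fun n => Lin (@swap_linear R (Y n) C E)))
    (Y_proper E injE) => [||z|n z].
  - exact: swap_bij.
  - by move=> n; exact: swap_bij.
  - by apply: hom_eq => u; apply: hom_eq.
  - by apply: hom_eq => u; apply: hom_eq.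
- exists b => n /Yb Y0 z; apply: hom_eq => u.
  by rewrite (Y0 u) /hom_fun !linear0.
- move=> n p q r A B CAB; have [I [injI [f fb]]] := Y_cls n.
  (* Dualizing into [I] and then into [E] transposes and reverses the pair twice, so it reappears
     unchanged. *)
  rewrite -[A]trmxK -[B]trmxK; apply: exact_on_hom => //.
  exact: (exact_on_bij fb) (exact_on_hom injI CAB).
(* Scalar matrices are symmetric, so the reversal only exchanges the pairs: [(x, y)] on [M] comes
   from [(y, x)] on [HomR M E]. *)
have trE (z : R) : z%:m = z%:m^T by rewrite tr_scalar_mx.
by split; apply: (exact_on_hom_inv (@char_module_cogenerator R)); rewrite -!trE.
Qed.
End ExactZeroDivisors.

Theorem proposition5p2 (R : comPzRingType) (C : lmodType R) (x y : R)
    (M : lmodType R) :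
  noetherian R ->
  semidualizing C ->
  exact_zero_divisors x y R^o ->
  exact_zero_divisors x y C ->
  range ( *:%R x : M -> M) <> [set 0] ->
  range ( *:%R x : M -> M) <> setT ->
  (PC_pd C M < +oo)%E \/ (FC_pd C M < +oo)%E \/ (IC_id C M < +oo)%E ->
  exact_zero_divisors x y M.
Proof.
move=> noethR sdC [_ _ Rxy _] [_ _ Cxy Cyx] xM0 xMT dimM.
(* [x = x * 1] lies in the image of [x] on [R], which is the kernel of [y]. *)
have yx0 : y * x = 0.
  have : range ( *:%R x : R^o -> R^o) x by exists 1; rewrite // -[LHS]/(x * 1) mulr1.
  by rewrite Rxy.
have xy0 : x * y = 0 by rewrite mulrC.
move/(exact_onP _ yx0) in Cxy; move/(exact_onP _ xy0) in Cyx.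
have injE := @char_module_injective R.
suff [Mxy Myx] : exact_on [set: M] (x%:M : 'M_1) (y%:M : 'M_1) /\
    exact_on [set: M] (y%:M : 'M_1) (x%:M : 'M_1).
  by split=> //; apply/exact_onP.
(* An infimum below [+oo] is witnessed by a proper resolution whose supremum is below [+oo]. *)
case: dimM => [|[|]] /infimum_lt_pinfty[t [X [X_proper ->]] X_sup].
- apply: exact_on_tensor_resolved X_proper X_sup => // [|P projP].
    exact: projective_regular.
  exact: injective_hom_projective.
- apply: exact_on_tensor_resolved X_proper X_sup => // [|P flatP].
    exact: flat_regular.
  exact: injective_hom_flat.
- exact: exact_on_hom_resolved X_proper X_sup.
Qed.
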